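(* Let $n\ge1$ and let $Q_1, Q_2\in\mathcal{Q}_n$ have parameters $r_1, r_2, s_1$ and $s_2$, respectively $\tilde{r}_1, \tilde{r}_2, \tilde{s}_1$ and $\tilde{s}_2$. If $r_1+2r_2=\tilde{r}_1+2\tilde{r}_2$ and $s_1+2s_2=\tilde{s}_1+2\tilde{s}_2$ (or vice versa, i.e. $r_1+2r_2=\tilde{s}_1+2\tilde{s}_2$ and $s_1+2s_2=\tilde{r}_1+2\tilde{r}_2$), then $Q_1$ is mutation equivalent to $Q_2$.
   Context: Quivers and mutation. A quiver is a finite directed graph. Let $Q$ be a quiver without loops and oriented $2$-cycles. The mutation of $Q$ at a vertex $k$ is the quiver $Q^*$ obtained as follows: add a new vertex $k^*$; if there are $r>0$ arrows $i\to k$, $s>0$ arrows $k\to j$ and $t\in\mathbb{Z}$ arrows $j\to i$ in $Q$, then there are $t-rs$ arrows $j\to i$ in $Q^*$ (a negative number of arrows means arrows in the opposite direction); for any vertex $i$ replace all arrows $i\to k$ by arrows $k^*\to i$ and all arrows $k\to i$ by arrows $i\to k^*$; remove $k$. Two quivers are mutation equivalent if one can be obtained (up to isomorphism) from the other by a finite sequence of mutations. A non-oriented cycle of length $m\ge 2$ is a quiver whose underlying graph is a cycle with $m$ vertices and $m$ edges (for $m=2$, a double arrow) and which is not an oriented cycle. Quivers of type $A_k$. Below, a quiver of type $A_k$ means a quiver mutation equivalent to an orientation of the Dynkin diagram $A_k$; equivalently (Buan-Vatne), a connected quiver with $k$ vertices such that all non-trivial cycles in the underlying graph (not passing through the same edge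 twice) are oriented and of length $3$; each vertex has at most four incident arrows; if a vertex has four incident arrows, two of them belong to one oriented $3$-cycle and the other two to another oriented $3$-cycle; if a vertex has three incident arrows, two of them belong to an oriented $3$-cycle and the third does not belong to any oriented $3$-cycle. The class $\mathcal{Q}_n$. It is the class of connected quivers $Q$ with $n+1$ vertices such that: (i) there is precisely one full subquiver which is a non-oriented cycle of length $\ge 2$ (if the length is two, it is a double arrow); (ii) for each arrow $\alpha: x\to y$ of this non-oriented cycle there may (or may not) be a vertex $z_\alpha$ not on the non-oriented cycle such that there is an oriented $3$-cycle $x\xrightarrow{\alpha} y\to z_\alpha\to x$, and apart from the arrows of these oriented $3$-cycles there are no other arrows incident to vertices on the non-oriented cycle; (iii) if all vertices of the non-oriented cycle and their incident arrows are removed, the result is a disjoint union of quivers $Q_\alpha$, one for each $z_\alpha$ (with $z_\alpha$ a vertex of $Q_\alpha$), each $Q_\alpha$ is a quiver of type $A_{k_\alpha}$ for some $k_\alpha\ge1$, the vertex $z_\alpha$ has at most two incident arrows in $Q_\alpha$, and if it has two, then $z_\alpha$ is a vertex of an oriented $3$-cycle in $Q_\alpha$. Convention: if the non-oriented cycle is a double arrow, only one of the two arrows is chosen to be part of the oriented $3$-cycle through a given vertex $z_\alpha$ (different vertices $z$ being attached to different arrows). Parameters. For $Q\in\mathcal{Q}_n$ fix a drawing of $Q$ in the plane without arrow-crossing, so that each arrow of the non-oriented cycle is clockwise or anti-clockwise oriented; this is unique up to reflection of the non-oriented cycle, i.e. up to changing the roles of clockwise and anti-clockwise. Then $r_1$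 is the number of arrows that are not part of any oriented $3$-cycle and that either lie on the non-oriented cycle and are oriented anti-clockwise, or lie in some $Q_\alpha$ with $\alpha$ an anti-clockwise arrow of the non-oriented cycle. And $r_2$ is the number of oriented $3$-cycles that either share an arrow $\alpha$ with the non-oriented cycle where $\alpha$ is oriented anti-clockwise, or lie in some $Q_\alpha$ with $\alpha$ an anti-clockwise arrow of the non-oriented cycle. The parameters $s_1,s_2$ are defined in the same way with ''clockwise'' instead of ''anti-clockwise''. *)

(* Defs.v *)
From HB Require Import structures.
From mathcomp Require Import all_boot.

Set Implicit Arguments.
Unset Strict Implicit.
Unset Printing Implicit Defensive.

(* Finite quivers, multiple arrows allowed, without loops and oriented
   2-cycles. *)
Record quiver := Quiver {
  vert : finType;
  arrow : finType;
  src : arrow -> vert;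
  tgt : arrow -> vert;
  no_loops : forall a, src a <> tgt a;
  no_2cycles : forall a b, ~ (tgt a = src b /\ tgt b = src a)
}.

Definition isomorphic (Q Q' : quiver) : Prop :=
  exists (f : vert Q -> vert Q') (g : arrow Q -> arrow Q'),
    [/\ bijective f, bijective g,
        forall a, src (g a) = f (src a) & forall a, tgt (g a) = f (tgt a)].

Definition joins (Q : quiver) (a : arrow Q) (x y : vert Q) : bool :=
  (src a == x) && (tgt a == y) || (src a == y) && (tgt a == x).

Definition connected (Q : quiver) : Prop :=
  forall x y : vert Q, connect (fun u v => [exists a, joins a u v]) x y.

Definition arrows_in (Q : quiver) (S : {set vert Q}) : {set arrow Q} :=
  [set a | src a \in S & tgt a \in S].

Definition sub_src (Q : quiver) (S : {set vert Q})
    (a : {a : arrow Q | a \in arrows_in S}) : {x : vert Q | x \in S}.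
Proof. by exists (src (val a)); have := valP a; rewrite inE => /andP[]. Defined.

Definition sub_tgt (Q : quiver) (S : {set vert Q})
    (a : {a : arrow Q | a \in arrows_in S}) : {x : vert Q | x \in S}.
Proof. by exists (tgt (val a)); have := valP a; rewrite inE => /andP[]. Defined.

Lemma sub_no_loops (Q : quiver) (S : {set vert Q})
    (a : {a : arrow Q | a \in arrows_in S}) : sub_src a <> sub_tgt a.
Proof. by move=> /(congr1 val); exact: no_loops. Qed.

Lemma sub_no_2cycles (Q : quiver) (S : {set vert Q})
    (a b : {a : arrow Q | a \in arrows_in S}) :
  ~ (sub_tgt a = sub_src b /\ sub_tgt b = sub_src a).
Proof.
by move=> [/(congr1 val) ab /(congr1 val) ba]; exact: (no_2cycles (conj ab ba)).
Qed.

Definition full_subquiver (Q : quiver) (S : {set vert Q}) : quiver :=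
  Quiver (@sub_no_loops Q S) (@sub_no_2cycles Q S).

Definition narrows (Q : quiver) (x y : vert Q) : nat :=
  #|[set a : arrow Q | src a == x & tgt a == y]|.

(* Number of arrows x -> y after mutation at k; the new vertex k^* is
   identified with k.  As there are no 2-cycles, at most one of the products
   below is nonzero, and the truncated difference is the positive part of the
   signed number of arrows. *)
Definition mut_narrows (Q : quiver) (k x y : vert Q) : nat :=
  if (x == k) || (y == k) then narrows y x
  else (narrows x y + narrows x k * narrows k y)
       - (narrows y x + narrows y k * narrows k x).

Lemma narrows_2cycle (Q : quiver) (x y : vert Q) : 0 < narrows x y -> narrows y x = 0.
Proof.
rewrite card_gt0 => /set0Pn[a]; rewrite inE => /andP[/eqP ax /eqP ay].
apply/eqP; rewrite cards_eq0; apply/set0Pn => -[b].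
rewrite inE => /andP[/eqP bY /eqP bX].
by apply: (@no_2cycles Q a b); rewrite ax ay bX bY.
Qed.

Lemma mut_narrows_2cycle (Q : quiver) (k x y : vert Q) :
  0 < mut_narrows k x y -> mut_narrows k y x = 0.
Proof.
rewrite /mut_narrows orbC; case: ifP => _; first exact: narrows_2cycle.
by rewrite subn_gt0 => /ltnW; rewrite -subn_eq0 => /eqP.
Qed.

Definition mut_arrow (Q : quiver) (k : vert Q) : finType :=
  {p : vert Q * vert Q & 'I_(mut_narrows k p.1 p.2)}.
Definition mut_src (Q : quiver) (k : vert Q) (a : mut_arrow k) : vert Q := (tag a).1.
Definition mut_tgt (Q : quiver) (k : vert Q) (a : mut_arrow k) : vert Q := (tag a).2.

Lemma mut_no_2cycles (Q : quiver) (k : vert Q) (a b : mut_arrow k) :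
  ~ (mut_tgt a = mut_src b /\ mut_tgt b = mut_src a).
Proof.
case: a b => [[x y] i] [[y' x'] j]; rewrite /mut_src /mut_tgt /= => -[yy' xx'].
subst y' x'; have := leq_ltn_trans (leq0n j) (ltn_ord j).
by rewrite /= mut_narrows_2cycle //; exact: leq_ltn_trans (leq0n i) (ltn_ord i).
Qed.

Lemma mut_no_loops (Q : quiver) (k : vert Q) (a : mut_arrow k) :
  mut_src a <> mut_tgt a.
Proof. by move=> e; apply: (@mut_no_2cycles Q k a a). Qed.

Definition mutate (Q : quiver) (k : vert Q) : quiver :=
  Quiver (@mut_no_loops Q k) (@mut_no_2cycles Q k).

Inductive mutation_equivalent : quiver -> quiver -> Prop :=
| mut_eq_iso (Q Q' : quiver) :
    isomorphic Q Q' -> mutation_equivalent Q Q'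
| mut_eq_step (Q Q' : quiver) (k : vert Q) :
    mutation_equivalent (mutate k) Q' -> mutation_equivalent Q Q'.

Definition orientation_of_A (k : nat) (Q : quiver) : Prop :=
  exists (v : 'I_k -> vert Q) (e : 'I_k.-1 -> arrow Q),
    [/\ bijective v, bijective e
      & forall (i : 'I_k.-1) (j j' : 'I_k),
          j = i :> nat -> j' = i.+1 :> nat -> joins (e i) (v j) (v j')].

Definition type_A (k : nat) (Q : quiver) : Prop :=
  exists2 Q', orientation_of_A k Q' & mutation_equivalent Q Q'.

(* The underlying graph of Q is a cycle of length m, with vertices v_i and
   edges e_i running between v_i and v_{i+1}, indices modulo m.  For m = 2
   this is a double edge. *)
Definition cycle_labelling (Q : quiver) (m : nat)
    (v : 'I_m -> vert Q) (e : 'I_m -> arrow Q) : Prop :=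
  [/\ bijective v, bijective e & forall i, joins (e i) (v i) (v (ordS i))].

Definition oriented_cycle (m : nat) (Q : quiver) : Prop :=
  exists (v : 'I_m -> vert Q) (e : 'I_m -> arrow Q),
    [/\ bijective v, bijective e
      & forall i, src (e i) = v i /\ tgt (e i) = v (ordS i)].

Definition nonoriented_cycle (Q : quiver) : Prop :=
  exists2 m, 2 <= m &
    (exists (v : 'I_m -> vert Q) (e : 'I_m -> arrow Q), cycle_labelling v e)
    /\ ~ oriented_cycle m Q.

(* Oriented 3-cycles, as sets of arrows. *)
Definition oriented_3cycle (Q : quiver) (T : {set arrow Q}) : bool :=
  [exists a, exists b, exists c,
    [&& T == [set a; b; c], tgt a == src b, tgt b == src c & tgt c == src a]].

Definition incident_arrows (Q : quiver) (S : {set vert Q}) (z : vert Q) :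
    {set arrow Q} :=
  [set a in arrows_in S | (src a == z) || (tgt a == z)].

(* S is the vertex set of the non-oriented cycle.  For an arrow a : x -> y of
   this cycle, tri a = Some (b, c) records the chosen oriented 3-cycle
   x -a-> y -b-> z_a -c-> x, so that z_a = tgt b, and tri a = None says that
   there is no vertex z_a.  The set U a consists of the vertices of Q_a; it is
   empty if there is no z_a.  For a double arrow, tri also encodes which of the
   two parallel arrows is chosen for the 3-cycle through a given z. *)
Record Qn_structure (Q : quiver) (S : {set vert Q})
    (tri : arrow Q -> option (arrow Q * arrow Q))
    (U : arrow Q -> {set vert Q}) : Prop := QnStructure {
  Qn_cycle : nonoriented_cycle (full_subquiver S);
  Qn_cycle_unique :
    forall S', nonoriented_cycle (full_subquiver S') -> S' = S;
  Qn_tri : forall a b c, tri a = Some (b, c) ->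
    [/\ a \in arrows_in S, tgt b \notin S
      & [/\ tgt a = src b, tgt b = src c & tgt c = src a]];
  Qn_no_other_arrows : forall d, (src d \in S) || (tgt d \in S) ->
    d \in arrows_in S \/
    exists a b c, tri a = Some (b, c) /\ (d = b \/ d = c);
  Qn_U0 : forall a, tri a = None -> U a = set0;
  Qn_U_disjoint : forall a a', a <> a' -> [disjoint U a & U a'];
  Qn_U_cover : forall v, v \notin S <-> exists a, v \in U a;
  Qn_U_arrows : forall d, src d \notin S -> tgt d \notin S ->
    exists a, d \in arrows_in (U a);
  Qn_type_A : forall a b c, tri a = Some (b, c) ->
    exists2 k, 1 <= k & type_A k (full_subquiver (U a));
  Qn_root : forall a b c, tri a = Some (b, c) ->
    [/\ tgt b \in U a,
        #|incident_arrows (U a) (tgt b)| <= 2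
      & #|incident_arrows (U a) (tgt b)| = 2 ->
        exists T : {set arrow Q},
          [/\ oriented_3cycle T, T \subset arrows_in (U a)
            & exists2 d, d \in T & src d = tgt b]]
}.

Definition in_Qn (n : nat) (Q : quiver) : Prop :=
  [/\ connected Q, #|vert Q| = n.+1
    & exists S tri U, @Qn_structure Q S tri U].

(* The oriented 3-cycles, with the convention for double arrows: a 3-cycle
   through an arrow of the non-oriented cycle has to be the chosen one.  This
   is automatic unless the non-oriented cycle is a double arrow. *)
Definition three_cycles (Q : quiver) (S : {set vert Q})
    (tri : arrow Q -> option (arrow Q * arrow Q)) : {set {set arrow Q}} :=
  [set T | oriented_3cycle T &
    [forall a in T :&: arrows_in S,
      if tri a is Some (b, c) then T == [set a; b; c] else false]].

Definition in_3cycle (Q : quiver) (S : {set vert Q})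
    (tri : arrow Q -> option (arrow Q * arrow Q)) (d : arrow Q) : bool :=
  [exists T in three_cycles S tri, d \in T].

(* Below, C is the set of all clockwise, or of all anti-clockwise, arrows of
   the non-oriented cycle. *)
Definition param_arrows (Q : quiver) (S : {set vert Q})
    (tri : arrow Q -> option (arrow Q * arrow Q))
    (U : arrow Q -> {set vert Q}) (C : {set arrow Q}) : nat :=
  #|[set d | ~~ in_3cycle S tri d &
      (d \in C) || [exists a in C, d \in arrows_in (U a)]]|.

Definition param_3cycles (Q : quiver) (S : {set vert Q})
    (tri : arrow Q -> option (arrow Q * arrow Q))
    (U : arrow Q -> {set vert Q}) (C : {set arrow Q}) : nat :=
  #|[set T in three_cycles S tri |
      [exists a in C, (a \in T) || (T \subset arrows_in (U a))]]|.

(* A plane drawing of the non-oriented cycle amounts to a labelling of its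
   vertices and arrows in clockwise order. *)
Definition clockwise (Q : quiver) (S : {set vert Q}) (m : nat)
    (v : 'I_m -> vert (full_subquiver S))
    (e : 'I_m -> arrow (full_subquiver S)) : {set arrow Q} :=
  [set val (e i) | i : 'I_m & src (e i) == v i].

Definition anticlockwise (Q : quiver) (S : {set vert Q}) (m : nat)
    (v : 'I_m -> vert (full_subquiver S))
    (e : 'I_m -> arrow (full_subquiver S)) : {set arrow Q} :=
  [set val (e i) | i : 'I_m & tgt (e i) == v i].

Definition has_parameters (Q : quiver) (r1 r2 s1 s2 : nat) : Prop :=
  exists (S : {set vert Q}) (tri : arrow Q -> option (arrow Q * arrow Q))
         (U : arrow Q -> {set vert Q}) (m : nat)
         (v : 'I_m -> vert (full_subquiver S))
         (e : 'I_m -> arrow (full_subquiver S)),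
    [/\ Qn_structure S tri U, 2 <= m, cycle_labelling v e,
        r1 = param_arrows S tri U (anticlockwise v e)
        /\ r2 = param_3cycles S tri U (anticlockwise v e)
      & s1 = param_arrows S tri U (clockwise v e)
        /\ s2 = param_3cycles S tri U (clockwise v e)].

(* Main.v *)
Require Import Defs.
From mathcomp Require Import all_boot zify.

(* The quivers of type A and those of the class Q_n are the quivers of triangulations of
   a polygon and of an annulus: they are encoded by lists of triangles whose sides are
   vertices of the quiver or boundary edges, and mutation is the flip of a diagonal.
   Triangulations of a polygon can be rooted at any of their diagonals; with the condition
   on z_a this makes Q_a a binary tree with root z_a.  A quiver of Q_n is then a cyclic word
   of arrows with binary trees glued to them, and r1 + 2 r2 (s1 + 2 s2) is the sum of
   1 + |tree| over its anti-clockwise (clockwise) arrows.  Flipping the root of a tree glued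
   to an arrow replaces this arrow by two arrows of the same direction and keeps these
   sums, so that every word can be reduced to a plain cycle with r1 + 2 r2 anti-clockwise
   and s1 + 2 s2 clockwise arrows, and flips at sources and sinks permute the arrows of
   such a cycle arbitrarily. *)

Set Implicit Arguments.
Unset Strict Implicit.
Unset Printing Implicit Defensive.

(** * Isomorphisms and mutation *)

(** Type A is defined through mutation, so the shape of [Q_a] cannot be read off its definition. It
    is obtained by showing that being the quiver of a triangulated polygon survives flips, starting
    from a linear quiver. A triangulation has two triangles on [z_a], while gluing needs all of
    [Q_a] on one side; the condition on the arrows at [z_a] is what excludes two nontrivial sides.
    The factor 2 in [r1 + 2 * r2] makes the parameters count edges of trees: a node with two
    children is a 3-cycle of weight 2, a node with one child is a free arrow of weight 1. A nonempty
    tree therefore weighs its number of nodes minus one, and the 3-cycle gluing it to the cycle adds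
    2. Quivers are compared by the multiplicities [narrows], so that a mutation is an identity
    between counts. The delicate point is the truncated subtraction in the mutation rule and in
    [encodes]; most side conditions on distinct labels serve to show that no arrows cancel at the
    flipped diagonal. *)

Lemma fiber_bij (A B K : finType) (f : A -> K) (g : B -> K) :
  (forall k, #|[set a | f a == k]| = #|[set b | g b == k]|) ->
  exists2 h : A -> B, bijective h & forall a, g (h a) = f a.
Proof.
move=> fg.
have sz k : size (enum [set a | f a == k]) = size (enum [set b | g b == k]).
  by rewrite -!cardE.
have hP (a : A) : {b | b \in [set b | g b == f a]}.
  by apply/sigW/set0Pn; rewrite -card_gt0 -fg card_gt0; apply/set0Pn; exists a; rewrite inE.
have h'P (b : B) : {a | a \in [set a | f a == g b]}.
  by apply/sigW/set0Pn; rewrite -card_gt0 fg card_gt0; apply/set0Pn; exists b; rewrite inE.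
(* Fibres over the same point are matched by position in their enumerations. The elements from [hP]
   and [h'P] are defaults of [nth] that are never reached. *)
pose h a := nth (sval (hP a)) (enum [set b | g b == f a])
  (index a (enum [set a' | f a' == f a])).
pose h' b := nth (sval (h'P b)) (enum [set a | f a == g b])
  (index b (enum [set b' | g b' == g b])).
have idx a : index a (enum [set a' | f a' == f a]) < size (enum [set b | g b == f a]).
  by rewrite -sz index_mem mem_enum inE.
have idx' b : index b (enum [set b' | g b' == g b]) < size (enum [set a | f a == g b]).
  by rewrite sz index_mem mem_enum inE.
have gh a : g (h a) = f a by have := mem_nth (sval (hP a)) (idx a); rewrite mem_enum inE => /eqP.
have fh b : f (h' b) = g b by have := mem_nth (sval (h'P b)) (idx' b);
  rewrite mem_enum inE => /eqP.
exists h => //; exists h'.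
  move=> a; rewrite /h'; move: (sval (h'P _)) => a0; rewrite gh index_uniq ?enum_uniq //.
  by rewrite nth_index // mem_enum inE.
move=> b; rewrite /h; move: (sval (hP _)) => b0; rewrite fh index_uniq ?enum_uniq //.
by rewrite nth_index // mem_enum inE.
Qed.

(** Parallel arrows are interchangeable, so [fiber_bij] for the maps from arrows to their pairs of
    endpoints supplies the bijection of arrows. Isomorphisms can thus be checked on multiplicities
    alone. *)
Lemma isomorphic_narrows (Q Q' : quiver) (f : vert Q -> vert Q') :
  bijective f -> (forall x y, narrows (f x) (f y) = narrows x y) -> isomorphic Q Q'.
Proof.
move=> bf ff; have [f' fK f'K] := bf.
have [|g bg gE] := @fiber_bij (arrow Q) (arrow Q') _
    (fun a => (f (src a), f (tgt a))) (fun a => (src a, tgt a)).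
  move=> [x y]; rewrite -[x]f'K -[y]f'K.
  transitivity (narrows (f' x) (f' y)); last rewrite -ff.
    by apply: eq_card => a; rewrite !inE; apply: etrans (xpair_eqE _ _ _ _) _;
      rewrite !(can_eq fK).
  by apply: eq_card => a; rewrite !inE; apply: esym (xpair_eqE _ _ _ _).
by exists f, g; split=> // a; case: (gE a).
Qed.

Lemma narrows_isomorphic (Q Q' : quiver) : isomorphic Q Q' ->
  exists2 f : vert Q -> vert Q', bijective f
    & forall x y, narrows (f x) (f y) = narrows x y.
Proof.
move=> [f [g [bf bg gs gt]]]; exists f => // x y.
have [g' gK g'K] := bg; have [f' fK _] := bf.
rewrite /narrows -(card_imset _ (can_inj gK)); apply: eq_card => a.
rewrite inE; apply/andP/imsetP => [[/eqP sx /eqP ty]|[b]].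
  by exists (g' a); rewrite ?g'K // inE -!(inj_eq (can_inj fK)) -gs -gt g'K sx ty !eqxx.
by rewrite inE => /andP[/eqP <- /eqP <-] ->; rewrite gs gt.
Qed.

Lemma narrows_mutate (Q : quiver) (k x y : vert Q) :
  @narrows (mutate k) x y = mut_narrows k x y.
Proof.
rewrite /narrows -sum1_card.
transitivity (\sum_(p : vert Q * vert Q | p == (x,
  y)) \sum_(j : 'I_(mut_narrows k p.1 p.2) | true) 1).
  rewrite sig_big_dep /=; apply: eq_bigl => -[[u v] j].
  by rewrite inE /src /tgt /= /mut_src /mut_tgt /= xpair_eqE andbT.
by rewrite big_pred1_eq /= sum1_card card_ord.
Qed.

Lemma narrowsxx (Q : quiver) (x : vert Q) : narrows x x = 0.
Proof.
by apply/eqP; rewrite cards_eq0; apply/set0Pn => -[a];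
  rewrite inE => /andP[/eqP <- /eqP /esym /no_loops].
Qed.

Lemma narrows_2cycleM (Q : quiver) (x y : vert Q) : narrows x y * narrows y x = 0.
Proof. by case: (posnP (narrows x y)) => [->//|/narrows_2cycle ->]; rewrite muln0. Qed.

Lemma isomorphic_sym (Q Q' : quiver) : isomorphic Q Q' -> isomorphic Q' Q.
Proof.
move=> /narrows_isomorphic[f [f' fK f'K] fE].
by apply: (@isomorphic_narrows _ _ f') => [|x y]; [exists f | rewrite -fE !f'K].
Qed.

Lemma isomorphic_trans (Q Q' Q'' : quiver) :
  isomorphic Q Q' -> isomorphic Q' Q'' -> isomorphic Q Q''.
Proof.
move=> /narrows_isomorphic[f bf fE] /narrows_isomorphic[g bg gE].
apply: (@isomorphic_narrows _ _ (g \o f)); first exact: bij_comp.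
by move=> x y /=; rewrite gE fE.
Qed.

Lemma isomorphic_mutate (Q Q' : quiver) (f : vert Q -> vert Q') (k : vert Q) :
  bijective f -> (forall x y, narrows (f x) (f y) = narrows x y) ->
  isomorphic (mutate k) (mutate (f k)).
Proof.
move=> bf fE; apply: (@isomorphic_narrows (mutate k) (mutate (f k)) f) => // x y.
by rewrite !narrows_mutate /mut_narrows !fE !(bij_eq bf).
Qed.

(** Reversing the arrows at [k] exchanges the two products of path counts through [k]. At most one
    of them is nonzero, so the second mutation takes back exactly the correction made by the
    first. *)
Lemma isomorphic_mutateK (Q : quiver) (k : vert Q) :
  isomorphic (@mutate (mutate k) k) Q.
Proof.
apply: (@isomorphic_narrows (@mutate (mutate k) k) Q id); first by exists id.
move=> x y; rewrite narrows_mutate /mut_narrows !narrows_mutate /mut_narrows !eqxx !orbT /=.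
have [->|xk] := eqVneq x k; first by rewrite !orbT.
have [->|yk] /= := eqVneq y k; first by [].
have := @narrows_2cycleM Q x y.
rewrite [@narrows Q k x * _]mulnC [@narrows Q k y * _]mulnC.
have : @narrows Q x k * @narrows Q k y * (@narrows Q y k * @narrows Q k x) = 0.
  by rewrite [@narrows Q y k * _]mulnC mulnACA narrows_2cycleM.
move: (@narrows Q x k * _) (@narrows Q y k * _) => u w.
by move=> /eqP + /eqP; rewrite !muln_eq0 => /orP[]/eqP-> /orP[]/eqP->; lia.
Qed.

Lemma mutation_equivalent_iso_l (Q Q' Q'' : quiver) :
  isomorphic Q Q' -> mutation_equivalent Q' Q'' -> mutation_equivalent Q Q''.
Proof.
move=> + h; elim: h Q => {Q' Q''} [Q' Q'' i|Q' Q'' k _ IH] Q QQ'.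
  exact/mut_eq_iso/(isomorphic_trans QQ').
have [f bf fE] := narrows_isomorphic QQ'; have [f' _ f'K] := bf.
apply: (@mut_eq_step _ _ (f' k)); apply: IH.
by rewrite -{2}[k]f'K; apply: isomorphic_mutate.
Qed.

Lemma mutation_equivalent_trans (Q Q' Q'' : quiver) :
  mutation_equivalent Q Q' -> mutation_equivalent Q' Q'' -> mutation_equivalent Q Q''.
Proof.
move=> h; elim: h Q'' => {Q Q'} [Q Q' i|Q Q' k _ IH] Q'' h.
  exact: mutation_equivalent_iso_l h.
by apply: (@mut_eq_step _ _ k); apply: IH.
Qed.

Lemma mutation_equivalent_sym (Q Q' : quiver) :
  mutation_equivalent Q Q' -> mutation_equivalent Q' Q.
Proof.
elim=> {Q Q'} [Q Q' i|Q Q' k _ IH]; first exact/mut_eq_iso/isomorphic_sym.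
apply: (mutation_equivalent_trans IH).
by apply: (@mut_eq_step (mutate k) _ k); apply/mut_eq_iso/isomorphic_mutateK.
Qed.

(** * Triangles and flips *)

Notation triangle V := (option V * option V * option V)%type.

(** The sides of a triangle are listed in cyclic order, each with an arrow to the next; [None] is a
    boundary edge and carries no arrows. *)
Definition tri_narrows (V : eqType) (p : triangle V) (x y : V) : nat :=
  ((p.1.1 == Some x) && (p.1.2 == Some y)) + ((p.1.2 == Some x) && (p.2 == Some y))
  + ((p.2 == Some x) && (p.1.1 == Some y)).

Definition tris_narrows (V : eqType) (L : seq (triangle V)) (x y : V) : nat :=
  \sum_(p <- L) tri_narrows p x y.

(** Opposite arrows coming from different triangles cancel, in accordance with the signed count in
    the mutation rule. *)
Definition encodes (Q : quiver) (L : seq (triangle (vert Q))) : Prop :=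
  forall x y, narrows x y = tris_narrows L x y - tris_narrows L y x.

Lemma tris_narrows_nil (V : eqType) (x y : V) : tris_narrows [::] x y = 0.
Proof. exact: big_nil. Qed.

Lemma tris_narrows_cons (V : eqType) p (L : seq (triangle V)) x y :
  tris_narrows (p :: L) x y = tri_narrows p x y + tris_narrows L x y.
Proof. exact: big_cons. Qed.

Lemma tris_narrows_cat (V : eqType) (L L' : seq (triangle V)) x y :
  tris_narrows (L ++ L') x y = tris_narrows L x y + tris_narrows L' x y.
Proof. exact: big_cat. Qed.

Lemma encodes_eq (Q : quiver) (L L' : seq (triangle (vert Q))) :
  (forall x y, tris_narrows L x y = tris_narrows L' x y) -> encodes L -> encodes L'.
Proof. by move=> e h x y; rewrite -!e. Qed.

Lemma tri_narrows_rot (V : eqType) (a b c : option V) x y :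
  tri_narrows (a, b, c) x y = tri_narrows (b, c, a) x y.
Proof. by rewrite /tri_narrows /= -addnA addnC. Qed.

(* [k] is a diagonal of the quadrilateral with sides [a, b, c, d]; the flip replaces it by the
   other diagonal. *)
Lemma encodes_flip (Q : quiver) (k : vert Q) (a b c d : option (vert Q))
    (L : seq (triangle (vert Q))) :
  Some k \notin [:: a; b; c; d] ->
  (forall x, ((a == Some x) || (c == Some x)) && ((b == Some x) || (d == Some x)) = false) ->
  (forall x, tris_narrows L x k = 0 /\ tris_narrows L k x = 0) ->
  encodes ((Some k, a, b) :: (Some k, c, d) :: L) ->
  @encodes (mutate k) ((Some k, b, c) :: (Some k, d, a) :: L).
Proof.
rewrite !inE !negb_or ![Some k == _]eq_sym => /and4P[/negbTE ka /negbTE kb /negbTE kc /negbTE kd].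
move=> dj kL h.
set L' := _ :: _.
suff main (x y : vert Q) : mut_narrows k x y = tris_narrows L' x y - tris_narrows L' y x.
  by move=> x y; rewrite narrows_mutate; exact: main.
rewrite /L' {L'}.
have ks z : z != k -> (Some k == Some z) = false.
  by move=> /negbTE zk; rewrite eq_sym; exact: zk.
(* By [dj] no vertex is joined to [k] by arrows of both directions, so that nothing is truncated
   here. *)
have hk z : z != k -> narrows z k = (b == Some z) + (d == Some z) /\ narrows k z = (a == Some z)
  + (c == Some z).
  move=> zk; have [z1 z2] := kL z; have := dj z.
  rewrite !h !tris_narrows_cons /tri_narrows /= z1 z2 ka kb kc kd eqxx ks //=.
  by case: (a == _); case: (b == _); case: (c == _); case: (d == _).
have [l1 l2] := (kL x, kL y).
have [->|xk] := eqVneq x k.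
  rewrite /mut_narrows eqxx; have [->|yk] := eqVneq y k.
    by rewrite /= narrowsxx subnn.
  rewrite /= (hk _ yk).1 !tris_narrows_cons /tri_narrows /= l2.1 l2.2 ka kb kc kd eqxx ks //=.
  have := dj y.
  by case: (a == _); case: (b == _); case: (c == _); case: (d == _).
have [->|yk] := eqVneq y k.
  rewrite /mut_narrows eqxx orbT.
  rewrite /= (hk _ xk).2 !tris_narrows_cons /tri_narrows /= l1.1 l1.2 ka kb kc kd eqxx ks //=.
  have := dj x.
  by case: (a == _); case: (b == _); case: (c == _); case: (d == _).
rewrite /mut_narrows (negbTE xk) (negbTE yk) /= (hk _ xk).1 (hk _ xk).2 (hk _ yk).1 (hk _ yk).2.
rewrite !h !tris_narrows_cons /tri_narrows /=.
rewrite !ks //=.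
rewrite !andbF !addn0.
move: (tris_narrows L x y) (tris_narrows L y x) => X Y.
(* Adding to both positive parts and truncating again equals truncating once. What remains is an
   untruncated identity in eight indicators: the paths through [k] between adjacent sides of a
   former triangle cancel its third arrow, the other two kinds of paths give the third arrows of the
   new triangles. *)
have subD m n p q : m - n + p - (n - m + q) = m + p - (n + q) by lia.
have eq_sub m n p q : m + q = p + n -> m - n = p - q by lia.
rewrite subD; apply: eq_sub; rewrite -!mulnb !mulnDl !mulnDr.
do 4![move: (nat_of_bool _) => ?]; do 4![move: (nat_of_bool _) => ?].
lia.
Qed.

(** * Quivers of type A *)

(** A triangulated polygon with a distinguished side: [Node v l r] starts with the triangle on [v],
    whose other sides carry the polygons [l] and [r]; [Leaf] is a boundary edge. *)
Inductive tree (V : Type) := Leaf | Node of V & tree V & tree V.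
Arguments Leaf {V}.

Fixpoint labels (V : Type) (t : tree V) : seq V :=
  if t is Node v l r then v :: labels l ++ labels r else [::].

Definition root (V : Type) (t : tree V) : option V :=
  if t is Node v _ _ then Some v else None.

Fixpoint tris (V : Type) (t : tree V) : seq (triangle V) :=
  if t is Node v l r then (Some v, root l, root r) :: tris l ++ tris r else [::].

Lemma root_labels (V : eqType) (t : tree V) x : root t = Some x -> x \in labels t.
Proof. by case: t => //= v l r [->]; exact: mem_head. Qed.

Lemma root_labelsF (V : eqType) (t : tree V) x : x \notin labels t -> (root t == Some x) = false.
Proof. by apply: contraNF => /eqP; exact: root_labels. Qed.

Lemma tris_narrows0l (V : eqType) (t : tree V) x y :
  x \notin labels t -> tris_narrows (tris t) x y = 0.
Proof.
elim: t => [|v l IHl r IHr] /=; first by rewrite tris_narrows_nil.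
rewrite inE mem_cat !negb_or => /and3P[xv xl xr].
rewrite tris_narrows_cons tris_narrows_cat IHl // IHr //.
rewrite /tri_narrows /= (root_labelsF xl) (root_labelsF xr).
by rewrite (_ : (Some v == Some x) = false) // eq_sym; apply/negbTE.
Qed.

Lemma tris_narrows0r (V : eqType) (t : tree V) x y :
  y \notin labels t -> tris_narrows (tris t) x y = 0.
Proof.
elim: t => [|v l IHl r IHr] /=; first by rewrite tris_narrows_nil.
rewrite inE mem_cat !negb_or => /and3P[xv xl xr].
rewrite tris_narrows_cons tris_narrows_cat IHl // IHr //.
rewrite /tri_narrows /= (root_labelsF xl) (root_labelsF xr).
by rewrite (_ : (Some v == Some y) = false) ?andbF // eq_sym; apply/negbTE.
Qed.

Definition tris_narrowsE :=
  (tris_narrows_cons, tris_narrows_cat, tris_narrows_nil).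

(** Lists of triangles that differ by reordering and by rotating single triangles give equal sums of
    indicators, with whole subtrees as atoms. *)
Ltac tris_lia :=
  move=> ? ?; rewrite /= ?tris_narrowsE /tri_narrows /= ?tris_narrowsE;
  do ?[move: (nat_of_bool _) => ?]; clear; lia.

(* [v] is a diagonal of a triangulated polygon; cutting along the remaining sides of its two
   triangles leaves triangulated polygons, the trees [a, b] and [c, d]. *)
Definition centred (Q : quiver) (v : vert Q) (a b c d : tree (vert Q)) : Prop :=
  let s := v :: labels a ++ labels b ++ labels c ++ labels d in
  [/\ uniq s, forall x, x \in s & encodes (tris (Node v a b) ++ tris (Node v c d))].

Definition polygonal (Q : quiver) : Prop :=
  forall v : vert Q, exists a b c d, centred v a b c d.

(** Label lists are compared through [count], which turns the permutation into an arithmetic goal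
    for [centred_lia]. *)
Lemma centred_eq (Q : quiver) (v v' : vert Q) a b c d a' b' c' d' :
  (forall p, count p (v :: labels a ++ labels b ++ labels c ++ labels d)
     = count p (v' :: labels a' ++ labels b' ++ labels c' ++ labels d')) ->
  (forall x y, tris_narrows (tris (Node v a b) ++ tris (Node v c d)) x y
     = tris_narrows (tris (Node v' a' b') ++ tris (Node v' c' d')) x y) ->
  centred v a b c d -> centred v' a' b' c' d'.
Proof.
move=> /permP sP LE [us ms eL]; split.
- by rewrite -(perm_uniq sP).
- by move=> x; rewrite -(perm_mem sP).
- exact: encodes_eq eL.
Qed.

Ltac centred_lia := apply: centred_eq;
  [by move=> ?; do ?[rewrite count_cat | progress rewrite /=]; clear; lia
  | by tris_lia].

Lemma centred_reroot (Q : quiver) (w : vert Q) (t : tree (vert Q)) : w \in labels t ->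
  (forall v b c d, centred v t b c d -> exists a' b' c' d', centred w a' b' c' d') /\
  (forall v a c d, centred v a t c d -> exists a' b' c' d', centred w a' b' c' d').
Proof.
elim: t => [|u e IHe f IHf] //=; rewrite inE mem_cat.
have r1 v b c d : centred v (Node u e f) b c d -> centred u e f b (Node v c d).
  by centred_lia.
have r2 v a c d : centred v a (Node u e f) c d -> centred u e f (Node v c d) a.
  by centred_lia.
case/or3P => [/eqP->|/IHe[h _]|/IHf[_ h]].
- by split=> v a c d h; [exists e, f, a, (Node v c d); apply: r1
                        | exists e, f, (Node v c d), a; apply: r2].
- by split=> v a c d h'; [apply: h (r1 _ _ _ _ h') | apply: h (r2 _ _ _ _ h')].
- by split=> v a c d h'; [apply: h (r1 _ _ _ _ h') | apply: h (r2 _ _ _ _ h')].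
Qed.

Lemma centred_polygonal (Q : quiver) (v : vert Q) a b c d :
  centred v a b c d -> polygonal Q.
Proof.
move=> h w; have [_ /(_ w) + _] := h.
have h' : centred v c d a b by move: h; centred_lia.
rewrite inE !mem_cat => /orP[/eqP->|]; first by exists a, b, c, d.
by case/or4P => /centred_reroot[h1 h2]; [apply: h1 h | apply: h2 h | apply: h1 h' | apply: h2 h'].
Qed.

Lemma polygonal_mutate (Q : quiver) (k : vert Q) : polygonal Q -> polygonal (mutate k).
Proof.
move=> /(_ k)[a [b [c [d [us ms eL]]]]].
(* A flip turns the diagonal inside its quadrilateral, so the four trees are shifted cyclically. *)
apply: (@centred_polygonal (mutate k) k b c d a); split.
- apply: etrans us; apply: perm_uniq; apply/permP => p.
  by rewrite /= !count_cat; lia.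
- by move=> x; have := ms x; rewrite !inE !mem_cat => /or4P[||->|/orP[]->];
  rewrite ?orbT // => ->; rewrite ?orbT.
- have /andP[+ us'] := us; rewrite !mem_cat !negb_or => /and4P[ka kb kc kd].
  pose L := tris a ++ tris b ++ tris c ++ tris d.
  apply: (@encodes_eq (mutate k) ((Some k, root b, root c) :: (Some k, root d, root a) :: L)).
    by tris_lia.
  apply: encodes_flip.
  + by rewrite !inE !negb_or ![Some k == _]eq_sym !root_labelsF.
  (* A common root of two of the trees would occur twice in the duplicate-free list of labels. *)
  + move=> x; apply/negP => /andP[h1 h2].
    have cnt_root (t : tree (vert Q)) : root t == Some x -> 0 < count_mem x (labels t).
      by move=> /eqP/root_labels; rewrite -has_pred1 has_count.
    have := count_uniq_mem x us';
      have := leq_b1 (x \in labels a ++ labels b ++ labels c ++ labels d).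
    move: (nat_of_bool _) => ?; rewrite !count_cat.
    by case/orP: h1 => /cnt_root; case/orP: h2 => /cnt_root; lia.
  + move=> x; rewrite /L !tris_narrowsE.
    by rewrite !(tris_narrows0l _ ka, tris_narrows0l _ kb, tris_narrows0l _ kc,
      tris_narrows0l _ kd)
      !(tris_narrows0r _ ka, tris_narrows0r _ kb, tris_narrows0r _ kc, tris_narrows0r _ kd).
  + by apply: encodes_eq eL; tris_lia.
Qed.

Fixpoint map_tree (V W : Type) (f : V -> W) (t : tree V) : tree W :=
  if t is Node v l r then Node (f v) (map_tree f l) (map_tree f r) else Leaf.

Lemma labels_map (V W : Type) (f : V -> W) t : labels (map_tree f t) = map f (labels t).
Proof. by elim: t => //= v l -> r ->; rewrite map_cat. Qed.

Lemma root_map (V W : Type) (f : V -> W) t : root (map_tree f t) = omap f (root t).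
Proof. by case: t. Qed.

Lemma tris_narrows_map (V W : eqType) (f : V -> W) t x y : injective f ->
  tris_narrows (tris (map_tree f t)) (f x) (f y) = tris_narrows (tris t) x y.
Proof.
move=> If; elim: t => [|v l IHl r IHr] /=; first by rewrite !tris_narrows_nil.
rewrite !tris_narrowsE IHl IHr; congr (_ + _).
have e o z : (omap f o == Some (f z)) = (o == Some z).
  by case: o => //= u; rewrite -[RHS](inj_eq If).
by rewrite /tri_narrows /= !root_map -[Some (f v)]/(omap f (Some v)) !e.
Qed.

Lemma polygonal_iso (Q Q' : quiver) : isomorphic Q Q' -> polygonal Q -> polygonal Q'.
Proof.
move=> /narrows_isomorphic[f bf fE] PQ v'; have [f' fK f'K] := bf.
have [a [b [c [d [us ms eL]]]]] := PQ (f' v').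
have If := can_inj fK.
exists (map_tree f a), (map_tree f b), (map_tree f c), (map_tree f d).
split.
- by rewrite !labels_map -!map_cat -[v']f'K -map_cons map_inj_uniq.
- move=> x; rewrite !labels_map -!map_cat -[v']f'K -map_cons -[x]f'K.
  exact: map_f.
- move=> x y; rewrite -[x]f'K -[y]f'K fE eL !tris_narrows_cat.
  by rewrite -[v']f'K -!(tris_narrows_map _ _ _ If) /= !f'K.
Qed.

Lemma narrows_sum (Q : quiver) (x y : vert Q) :
  narrows x y = \sum_(a : arrow Q) ((src a == x) && (tgt a == y)).
Proof.
by rewrite /narrows -sum1_card [LHS]big_mkcond; apply: eq_bigr => a _; rewrite inE; case: ifP.
Qed.

(* [d j] says whether the arrow between [v j] and [v j.+1] starts at [v j]. *)
Fixpoint path_tree (V : Type) (v : nat -> V) (d : nat -> bool) (i m : nat) : tree V :=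
  if m is m'.+1 then
    let t := path_tree v d i.+1 m' in
    if d i then Node (v i) t Leaf else Node (v i) Leaf t
  else Node (v i) Leaf Leaf.

Lemma labels_path (V : Type) (v : nat -> V) d i m :
  labels (path_tree v d i m) = map v (iota i m.+1).
Proof.
elim: m i => //= m IHm i.
by case: (d i); rewrite /= ?cats0 IHm.
Qed.

Lemma tris_narrows_path (V : eqType) (v : nat -> V) d i m x y :
  tris_narrows (tris (path_tree v d i m)) x y =
  \sum_(i <= j < i + m) (((if d j then v j else v j.+1) == x)
                         && ((if d j then v j.+1 else v j) == y)).
Proof.
have root_path i' m' : root (path_tree v d i' m') = Some (v i').
  by case: m' => //= m'; case: (d i').
elim: m i => [|m IHm] i.
  by rewrite addn0 big_geq //= !tris_narrowsE /tri_narrows /= !andbF.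
rewrite big_ltn ?addnS ?ltnS ?leq_addr // -addSn -IHm /=.
have e (u w : V) : (Some u == Some w) = (u == w) by [].
by case: (d i); rewrite /= !tris_narrowsE /tri_narrows /= root_path !e !andbF ?addn0 ?add0n.
Qed.

(** A linear quiver is a triangulation in which every triangle has a boundary side; the direction of
    an arrow decides which child is the [Leaf]. *)
Lemma orientation_polygonal (k : nat) (Q : quiver) : orientation_of_A k Q -> polygonal Q.
Proof.
case: k => [|n] [v [e [bv be ve]]]; first by move=> x; have [v' _ /(_ x)] := bv; case: (v' x).
pose vv i := v (inord i).
pose d i := if insub i is Some j then src (e j) == vv i else false.
have [a [b tE]] : exists a b, path_tree vv d 0 n = Node (vv 0) a b.
  have node m : exists a b, path_tree vv d 0 m = Node (vv 0) a b; last exact: node.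
  by case: m => [|m]; [exists Leaf, Leaf | rewrite /=; case: (d 0); do 2!eexists].
(* Seen from its end [vv 0], the path lies in one triangle, and the other triangle on [vv 0] has two
   boundary sides. *)
apply: (@centred_polygonal _ (vv 0) a b Leaf Leaf).
have lE : vv 0 :: labels a ++ labels b ++ labels Leaf ++ labels Leaf = map v (enum 'I_n.+1).
  rewrite cats0 -[LHS]/(labels (Node (vv 0) a b)) -tE labels_path -val_enum_ord -map_comp.
  by apply: eq_map => i /=; rewrite /vv inord_val.
have lvE x : x \in map v (enum 'I_n.+1).
  by have [v' _ v'K] := bv; rewrite -[x]v'K map_f ?mem_enum.
split; rewrite ?lE //; first by rewrite map_inj_uniq ?enum_uniq //; exact: bij_inj.
have nE x y : narrows x y = tris_narrows (tris (path_tree vv d 0 n)) x y.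
  rewrite narrows_sum tris_narrows_path add0n big_mkord (reindex e) /=; last exact: onW_bij.
  apply: eq_bigr => i _.
  rewrite /d valK.
  have ei : joins (e i) (vv i) (vv i.+1).
    by apply: ve; rewrite inordK // ltnS ?ltn_ord // ltnW.
  have [s|s] := eqVneq (src (e i)) (vv i).
    move: ei; rewrite /joins s eqxx /= => /orP[/eqP->//|/andP[/eqP <- /eqP t]].
    by have := @no_loops _ (e i); rewrite s t.
  by move: ei; rewrite /joins (negbTE s) /= => /andP[/eqP-> /eqP->].
move=> x y; rewrite -tE !tris_narrows_cat /= !tris_narrowsE /tri_narrows /= !andbF !addn0.
have := narrows_2cycleM x y; rewrite !nE.
case: (tris_narrows _ x y) => // p; case: (tris_narrows _ y x) => // q; rewrite ?subn0 //.
Qed.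

Lemma type_A_polygonal (k : nat) (Q : quiver) : type_A k Q -> polygonal Q.
Proof.
case=> Q' /orientation_polygonal + h.
elim: h => {Q Q'} [Q Q' /isomorphic_sym|Q Q' v _ IH /IH]; first exact: polygonal_iso.
(* The property is known after the mutation at [v]; mutating once more at [v] brings it back. *)
by move=> /(@polygonal_mutate (mutate v) v); apply: polygonal_iso; exact: isomorphic_mutateK.
Qed.

(** * Rooted quivers of type A *)

Lemma tri_narrows_node0l (V : eqType) (v : V) l r x y :
  uniq (labels (Node v l r)) -> x \in labels l -> y \in labels l ->
  tri_narrows (Some v, root l, root r) x y = 0.
Proof.
rewrite /= mem_cat negb_or cat_uniq => /andP[/andP[vl vr] /and3P[_ /hasPn lr _]] xl yl.
have vx z : z \in labels l -> (Some v == Some z) = false.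
  by move=> zl; apply: contraNF vl => /eqP[->].
have rF z : z \in labels l -> (root r == Some z) = false.
  by move=> zl; apply: root_labelsF; apply: contraL zl; exact: lr.
by rewrite /tri_narrows /= !vx ?rF ?andbF.
Qed.

Lemma tri_narrows_node0r (V : eqType) (v : V) l r x y :
  uniq (labels (Node v l r)) -> x \in labels r -> y \in labels r ->
  tri_narrows (Some v, root l, root r) x y = 0.
Proof.
move=> u xr yr; rewrite tri_narrows_rot.
have := @tri_narrows_node0l _ v r l y x;
  rewrite /= uniq_catC mem_cat orbC -mem_cat => /(_ u yr xr).
by rewrite /tri_narrows /=; lia.
Qed.

Lemma tris_narrows_gt0 (V : eqType) (t : tree V) x y :
  0 < tris_narrows (tris t) x y -> x \in labels t /\ y \in labels t.
Proof.
by move=> h; split; apply: contraLR h => h; rewrite ?(tris_narrows0l _ h) ?(tris_narrows0r _ h).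
Qed.

Lemma tris_narrows_anti (V : eqType) (t : tree V) x y :
  uniq (labels t) -> 0 < tris_narrows (tris t) x y -> tris_narrows (tris t) y x = 0.
Proof.
elim: t => [|v l IHl r IHr] u; first by rewrite tris_narrows_nil.
have := u => /= /andP[]; rewrite mem_cat negb_or cat_uniq => /andP[vl vr] /and3P[ul /hasPn lr ur].
have le1 z : (Some v == Some z) + (root l == Some z) + (root r == Some z) <= 1.
  case: eqP => [[<-]|_]; first by rewrite !root_labelsF.
  case: eqP => [/root_labels|_]; last by case: eqP.
  by move=> /(contraL (lr z))/root_labelsF->.
rewrite !tris_narrowsE.
have [l0|lp _] := posnP (tris_narrows (tris l) x y); last first.
  have [xl yl] := tris_narrows_gt0 lp.
  rewrite (tri_narrows_node0l u) // (IHl ul) // tris_narrows0l //.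
  exact: contraL (lr y) yl.
have [r0|rp _] := posnP (tris_narrows (tris r) x y); last first.
  have [xr yr] := tris_narrows_gt0 rp.
  by rewrite (tri_narrows_node0r u) // (IHr ur) // tris_narrows0l // lr.
rewrite l0 r0 !addn0 => h.
have [-> | /tris_narrows_gt0[yl xl]] := posnP (tris_narrows (tris l) y x); last first.
  by move: h; rewrite (tri_narrows_node0l u).
have [-> | /tris_narrows_gt0[yl xl]] := posnP (tris_narrows (tris r) y x); last first.
  by move: h; rewrite (tri_narrows_node0r u).
move: h (le1 x) (le1 y); rewrite /tri_narrows /=.
by case: (Some v == Some x); case: (root l == Some x); case: (root r == Some x) => //=;
   case: (Some v == Some y); case: (root l == Some y); case: (root r == Some y).
Qed.

(** Only arrows between labels are constrained, so the notion passes to subtrees and ignores how the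
    tree is attached to the rest of the quiver. *)
Definition realized (Q : quiver) (t : tree (vert Q)) : Prop :=
  uniq (labels t) /\
  {in labels t &, forall x y, narrows x y = tris_narrows (tris t) x y}.

Lemma realized_left (Q : quiver) (v : vert Q) l r : realized (Node v l r) -> realized l.
Proof.
move=> [u h]; have := u => /= /andP[_]; rewrite cat_uniq => /and3P[ul /hasPn lr _].
split=> // x y xl yl; rewrite h /= ?inE ?mem_cat ?xl ?yl ?orbT //.
rewrite !tris_narrowsE (tri_narrows_node0l u) // [tris_narrows (tris r) _ _]tris_narrows0l ?addn0
  //.
exact: contraL (lr x) xl.
Qed.

Lemma realized_right (Q : quiver) (v : vert Q) l r : realized (Node v l r) -> realized r.
Proof.
move=> [u h]; have := u => /= /andP[_]; rewrite cat_uniq => /and3P[_ /hasPn lr ur].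
split=> // x y xr yr; rewrite h /= ?inE ?mem_cat ?xr ?yr ?orbT //.
by rewrite !tris_narrowsE (tri_narrows_node0r u) // [tris_narrows (tris l) _ _]tris_narrows0l ?lr.
Qed.

Lemma narrows_gt0P (Q : quiver) (x y : vert Q) :
  reflect (exists2 d : arrow Q, src d = x & tgt d = y) (0 < narrows x y).
Proof.
rewrite /narrows card_gt0; apply: (iffP (set0Pn _)) => [[d]|[d <- <-]]; last first.
  by exists d; rewrite inE !eqxx.
by rewrite inE => /andP[/eqP sd /eqP td]; exists d.
Qed.

Lemma oriented_3cycle_rot (Q : quiver) (T : {set arrow Q}) d :
  oriented_3cycle T -> d \in T -> exists d' d'',
    [/\ T = [set d; d'; d''], tgt d = src d', tgt d' = src d'' & tgt d'' = src d].
Proof.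
move=> /existsP[a /existsP[b /existsP[c /and4P[/eqP -> /eqP ab /eqP bc /eqP ca]]]].
rewrite !inE -orbA => /or3P[]/eqP->; [exists b, c | exists c, a | exists a, b]; split=> //.
all: by apply/setP => z; rewrite !inE; case: (z == a); case: (z == b); case: (z == c).
Qed.

Lemma narrows_sub (Q : quiver) (U : {set vert Q}) (x y : vert (full_subquiver U)) :
  narrows x y = narrows (val x) (val y).
Proof.
rewrite /narrows -(card_imset _ val_inj); apply: eq_card => d.
rewrite inE; apply/imsetP/andP => [[d' + ->]|[/eqP dx /eqP dy]].
  by rewrite inE => /andP[/eqP <- /eqP <-].
have dU : d \in arrows_in U by rewrite inE dx dy (valP x) (valP y).
by exists (Sub d dU) => //; rewrite inE -!val_eqE /= dx dy !eqxx.
Qed.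

Lemma pmap_root (V : eqType) (s : seq (tree V)) : 
  subseq (pmap (@root V) s) (flatten (map (@labels V) s)).
Proof.
elim: s => //= t s IHs; case: t => [|v l r] //=; rewrite eqxx.
exact: subseq_trans IHs (suffix_subseq _ _).
Qed.

Lemma count_pmap_root (V : eqType) (s : seq (tree V)) (x : V) :
  count_mem x (pmap (@root V) s) = \sum_(t <- s) (root t == Some x).
Proof.
elim: s => [|t s IHs]; first by rewrite big_nil.
by rewrite big_cons -IHs; case: t.
Qed.

(** Meant for the multiplicities of one vertex in the label lists of four disjoint trees. *)
Lemma sum4_le1 (m n p q : nat) : m + (n + (p + q)) <= 1 ->
  [/\ 0 < m -> [/\ n = 0, p = 0 & q = 0], 0 < n -> [/\ m = 0, p = 0 & q = 0],
      0 < p -> [/\ m = 0, n = 0 & q = 0] & 0 < q -> [/\ m = 0, n = 0 & p = 0]].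
Proof. by move=> h; split=> h'; split; lia. Qed.

(** If one of the two triangles on [z] has only boundary sides besides [z], the other one is the top
    of the required tree. Otherwise the bound on incident arrows leaves one non-boundary side in
    each triangle. These sides are the only neighbours of [z], and they lie on different sides of
    the diagonal [z], so no arrow joins them; this contradicts the oriented 3-cycle through [z]. *)
Lemma realized_rooted (Q : quiver) (U : {set vert Q}) (z : vert Q) :
  polygonal (full_subquiver U) -> z \in U ->
  #|incident_arrows U z| <= 2 ->
  (#|incident_arrows U z| = 2 -> exists T : {set arrow Q},
    [/\ oriented_3cycle T, T \subset arrows_in U & exists2 d, d \in T & src d = z]) ->
  exists l r, realized (Node z l r) /\ labels (Node z l r) =i U.
Proof.
move=> P zU inc2 inc3.
have [a' [b' [c' [d' [us' ms' eL']]]]] := P (Sub z zU).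
pose m := map_tree (val : vert (full_subquiver U) -> vert Q).
have [a aE] : {a | a = m a'} by exists (m a').
have [b bE] : {a | a = m b'} by exists (m b').
have [c cE] : {a | a = m c'} by exists (m c').
have [d dE] : {a | a = m d'} by exists (m d').
have sE : z :: labels a ++ labels b ++ labels c ++ labels d
  = map val (Sub z zU :: labels a' ++ labels b' ++ labels c' ++ labels d').
  by rewrite aE bE cE dE !labels_map -!map_cat.
have us : uniq (z :: labels a ++ labels b ++ labels c ++ labels d).
  by rewrite sE map_inj_uniq //; exact: val_inj.
have ms : z :: labels a ++ labels b ++ labels c ++ labels d =i U.
  move=> x; rewrite sE; apply/mapP/idP => [[x' _ ->]|xU]; first exact: (valP x').
  by exists (Sub x xU).
have eL x y : x \in U -> y \in U -> narrows x y
    = tris_narrows (tris (Node z a b) ++ tris (Node z c d)) x y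
    - tris_narrows (tris (Node z a b) ++ tris (Node z c d)) y x.
  move=> xU yU; have := eL' (Sub x xU) (Sub y yU); rewrite narrows_sub => ->.
  have -> : tris (Node z a b) = tris (m (Node (Sub z zU) a' b')) by rewrite aE bE.
  have -> : tris (Node z c d) = tris (m (Node (Sub z zU) c' d')) by rewrite cE dE.
  rewrite -[x]/(val (Sub x xU : vert (full_subquiver U))).
  rewrite -[y]/(val (Sub y yU : vert (full_subquiver U))).
  by rewrite !tris_narrows_cat !tris_narrows_map //; exact: val_inj.
move: us => /=; rewrite !mem_cat !negb_or => /andP[/and4P[za zb zc zd] us].
pose R := pmap (@root (vert Q)) [:: a; b; c; d].
have uR : uniq R.
  by apply: subseq_uniq (pmap_root _) _; rewrite /= cats0.
have le1 x : (root a == Some x) + (root b == Some x) + (root c == Some x) + (root d == Some x) <=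
  1.
  have <- : count_mem x R = (root a == Some x) + (root b == Some x) + (root c == Some x) + (root
    d == Some x).
    by rewrite count_pmap_root !big_cons big_nil addn0 !addnA.
  by rewrite count_uniq_mem // leq_b1.
have rz (t : tree (vert Q)) : z \notin labels t -> (root t == Some z) = false by exact:
  root_labelsF.
have zx x : x != z -> (Some z == Some x) = false.
  by move=> /negbTE xz; rewrite eq_sym; exact: xz.
have out x : x != z -> x \in U -> narrows z x = (root a == Some x) + (root c == Some x).
  move=> xz xU; rewrite eL // !tris_narrows_cat /= !tris_narrowsE !(tris_narrows0l _ za,
    tris_narrows0l _ zb,
    tris_narrows0l _ zc, tris_narrows0l _ zd, tris_narrows0r _ za, tris_narrows0r _ zb,
    tris_narrows0r _ zc, tris_narrows0r _ zd) /tri_narrows /= (zx _ xz) eqxx !rz //.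
  by move: (le1 x); case: (root a == _); case: (root b == _); case: (root c == _);
    case: (root d == _).
have inc x : x != z -> x \in U -> narrows x z = (root b == Some x) + (root d == Some x).
  move=> xz xU; rewrite eL // !tris_narrows_cat /= !tris_narrowsE !(tris_narrows0l _ za,
    tris_narrows0l _ zb,
    tris_narrows0l _ zc, tris_narrows0l _ zd, tris_narrows0r _ za, tris_narrows0r _ zb,
    tris_narrows0r _ zc, tris_narrows0r _ zd) /tri_narrows /= (zx _ xz) eqxx !rz //.
  by move: (le1 x); case: (root a == _); case: (root b == _); case: (root c == _);
    case: (root d == _).
have RU x : x \in R -> x \in U /\ x != z.
  move=> xR; have := mem_subseq (pmap_root _) xR; rewrite /= cats0 => xs.
  split; first by rewrite -ms inE xs orbT.
  by apply: contraTneq xs => ->; rewrite !mem_cat !negb_or za zb zc.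
(* Each root in [R] is the other end of an arrow at [z], and distinct roots need distinct arrows. *)
have leR : size R <= #|incident_arrows U z|.
  pose other (f : arrow Q) := if src f == z then tgt f else src f.
  apply: leq_trans (leq_imset_card other _); rewrite -(card_uniqP uR).
  apply: subset_leq_card; apply/subsetP => x xR; have [xU xz] := RU x xR.
  have : 0 < narrows z x \/ 0 < narrows x z.
    rewrite out // inc //; move: xR;
      rewrite -has_pred1 has_count count_pmap_root !big_cons big_nil.
    by case: (root a == _); case: (root b == _); case: (root c == _); case: (root d == _); auto.
  case=> /narrows_gt0P[f sf tf]; apply/imsetP; exists f;
    rewrite ?inE ?sf ?tf ?eqxx ?zU ?xU ?orbT //.
    by rewrite /other sf eqxx.
  by rewrite /other sf (negbTE xz).
have sub (l r : tree (vert Q)) : perm_eq (labels (Node z l r)) (z :: labels a ++ labels b ++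
  labels c ++ labels d) ->
  (forall x y, tris_narrows (tris (Node z a b) ++ tris (Node z c d)) x y = tris_narrows (tris
    (Node z l r)) x y) ->
  exists l r, realized (Node z l r) /\ labels (Node z l r) =i U.
  move=> lE nE; exists l, r.
  have lU : labels (Node z l r) =i U by move=> x; rewrite (perm_mem lE) ms.
  have ul : uniq (labels (Node z l r)).
    by rewrite (perm_uniq lE) /= !mem_cat !negb_or za zb zc zd.
  split=> //; split=> // x y; rewrite !lU => xU yU; rewrite eL // !nE.
  have [->//|/(tris_narrows_anti ul) ->] := posnP (tris_narrows (tris (Node z l r)) x y).
  by rewrite subn0.
(* With at most two roots in total, a configuration with roots in both triangles has exactly one in
   each. *)
have triv : (c = Leaf /\ d = Leaf) \/ (a = Leaf /\ b = Leaf) \/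
    2 <= size R /\ ((root a != None) + (root b != None) <= 1) /\ ((root c != None) + (root d !=
      None) <= 1).
  move: (leq_trans leR inc2); rewrite /R.
  by case: (a) => [|? ? ?]; case: (b) => [|? ? ?]; case: (c) => [|? ? ?];
    case: (d) => [|? ? ?] //=; auto.
case: triv => [[cL dL]|[[aL bL]|[R2 [ab1 cd1]]]].
- apply: (sub a b) => [|x y]; first by rewrite cL dL !cats0.
  by rewrite cL dL /= !tris_narrowsE /tri_narrows /= !andbF !addn0.
- apply: (sub c d) => [|x y]; first by rewrite aL bL.
  by rewrite aL bL /= !tris_narrowsE /tri_narrows /= !andbF !addn0.
have {}R2 : size R = 2 by apply/eqP; rewrite eqn_leq R2 (leq_trans leR).
have [|T [T3 TU [f fT sf]]] := inc3; first by apply/eqP; rewrite eqn_leq inc2 -R2.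
have [g [h [TE fg gh hf]]] := oriented_3cycle_rot T3 fT.
have Tin e : e \in T -> src e \in U /\ tgt e \in U.
  by move=> /(subsetP TU); rewrite inE => /andP.
have [_ xU] := Tin f fT; have [|_ yU] := Tin g; first by rewrite TE !inE eqxx orbT.
set x := tgt f in fg xU; set y := tgt g in gh yU.
have xz : x != z by apply/eqP; rewrite -sf => /esym /no_loops.
have yz : y != z by apply/eqP; rewrite gh -sf -hf => /no_loops.
have : 0 < narrows z x by apply/narrows_gt0P; exists f.
have : 0 < narrows x y by apply/narrows_gt0P; exists g.
have : 0 < narrows y z by apply/narrows_gt0P; exists h; rewrite // hf.
have none (o o' : option (vert Q)) v : (o != None) + (o' != None) <= 1 -> o = Some v -> o' = None.
  by case: o => [?|] //; case: o'.
rewrite out // inc // eL // => hy hxy hx; exfalso; move: hxy.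
rewrite [X in X - _](_ : _ = 0) //.
have disj w (t : tree (vert Q)) : root t = Some w -> 0 < count_mem w (labels t).
  by move=> /root_labels; rewrite -has_pred1 has_count.
have cw w := leq_trans (eq_leq (count_uniq_mem w us)) (leq_b1 _).
have notin w (t : tree (vert Q)) : count_mem w (labels t) = 0 -> w \notin labels t.
  by rewrite -has_pred1 has_count => ->.
rewrite !tris_narrows_cat /= !tris_narrowsE /tri_narrows /= (zx x) // (zx y) // !andbF !add0n
  !addn0.
(* The out-neighbour [x] is the root of [a] or [c], the in-neighbour [y] that of [b] or [d]. Both in
   one triangle contradicts [ab1] or [cd1]; in different triangles, disjointness of the labels
   leaves no triangle with an arrow from [x] to [y]. *)
move: hx hy (cw x) (cw y); rewrite !addn_gt0 !lt0b !count_cat.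
case/orP => /eqP ax; case/orP => /eqP dy.
- by have := none _ _ _ ab1 ax; rewrite dy.
- rewrite (none _ _ _ ab1 ax) andbF; rewrite addnC in cd1; rewrite (none _ _ _ cd1 dy) /=.
  case/sum4_le1 => /(_ (disj _ _ ax))[/notin xb /notin xc /notin xd] _ _ _.
  case/sum4_le1 => _ _ _ /(_ (disj _ _ dy))[/notin ya _ _].
  by rewrite (tris_narrows0r x ya) (tris_narrows0l y xb) (tris_narrows0l y xc) (tris_narrows0l y
    xd).
- rewrite (none _ _ _ cd1 ax) andbF; rewrite addnC in ab1; rewrite (none _ _ _ ab1 dy) /=.
  case/sum4_le1 => _ _ /(_ (disj _ _ ax))[/notin xa /notin xb /notin xd] _.
  case/sum4_le1 => _ /(_ (disj _ _ dy))[_ /notin yc _] _ _.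
  by rewrite (tris_narrows0r x yc) (tris_narrows0l y xa) (tris_narrows0l y xb) (tris_narrows0l y
    xd).
- by have := none _ _ _ cd1 ax; rewrite dy.
Qed.

(** * Counting arrows and 3-cycles *)

Lemma sum_disjoint_union (I T : finType) (C : {set I}) (F : I -> {set T}) (E : {set T})
    (f : T -> nat) :
  (forall x, x \in E <-> exists2 i, i \in C & x \in F i) ->
  (forall i j x, i \in C -> j \in C -> x \in F i -> x \in F j -> i = j) ->
  \sum_(x in E) f x = \sum_(i in C) \sum_(x in F i) f x.
Proof.
move=> EF Fd.
rewrite (exchange_big_dep (mem E)) /=; last by move=> i x iC xF; apply/EF; exists i.
apply: eq_bigr => x /EF[i iC xF].
by rewrite (big_pred1 i) // => j /=; apply/andP/eqP => [[jC xj]|->]; [apply: Fd xF|].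
Qed.

Lemma card_disjoint_union (I T : finType) (C : {set I}) (F : I -> {set T}) (E : {set T}) :
  (forall x, x \in E <-> exists2 i, i \in C & x \in F i) ->
  (forall i j x, i \in C -> j \in C -> x \in F i -> x \in F j -> i = j) ->
  #|E| = \sum_(i in C) #|F i|.
Proof.
move=> EF Fd; rewrite -sum1_card (sum_disjoint_union _ EF Fd).
by apply: eq_bigr => i _; rewrite sum1_card.
Qed.

Section Weight.
Variables (Q : quiver) (Ts : {set {set arrow Q}}).
Hypothesis Ts_3cycle : forall T, T \in Ts -> oriented_3cycle T.

Definition covered (d : arrow Q) : bool := [exists T in Ts, d \in T].

(** The contribution of the arrows in [F] to [r1 + 2 * r2] or [s1 + 2 * s2]. An arrow counts as
    covered even if its 3-cycle leaves [F], so additivity over a partition requires that no 3-cycle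
    is cut. *)
Definition weight (F : {set arrow Q}) : nat :=
  #|[set d in F | ~~ covered d]| + 2 * #|[set T in Ts | T \subset F]|.

Lemma oriented_3cycle_neq0 (T : {set arrow Q}) : oriented_3cycle T -> T != set0.
Proof.
move=> /existsP[a /existsP[b /existsP[c /and4P[/eqP -> _ _ _]]]].
by apply/set0Pn; exists a; rewrite !inE eqxx.
Qed.

Lemma weight_partition (I : finType) (C : {set I}) (F : I -> {set arrow Q}) (E : {set arrow Q}) :
  (forall d, d \in E <-> exists2 i, i \in C & d \in F i) ->
  (forall i j d, i \in C -> j \in C -> d \in F i -> d \in F j -> i = j) ->
  (forall T, T \in Ts -> T \subset E -> exists2 i, i \in C & T \subset F i) ->
  weight E = \sum_(i in C) weight (F i).
Proof.
move=> EF Fd ET; rewrite /weight big_split -big_distrr /=; congr (_ + 2 * _).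
  apply: card_disjoint_union => [d|i j d iC jC]; last first.
    by rewrite !inE => /andP[di _] /andP[dj _]; apply: Fd di dj.
  rewrite inE; split=> [/andP[/EF[i iC di] nd]|[i iC]].
    by exists i; rewrite ?inE ?di.
  by rewrite inE => /andP[di ->]; rewrite andbT; apply/EF; exists i.
apply: card_disjoint_union => [T|i j T iC jC].
  rewrite inE; split=> [/andP[TT /(ET _ TT)[i iC Ti]]|[i iC]].
    by exists i; rewrite ?inE ?TT.
  rewrite inE => /andP[-> Ti]; apply/subsetP => d /(subsetP Ti) di.
  by apply/EF; exists i.
rewrite !inE => /andP[/Ts_3cycle/oriented_3cycle_neq0/set0Pn[d dT] Ti] /andP[_ Tj].
by apply: (Fd i j d); rewrite ?(subsetP Ti) ?(subsetP Tj).
Qed.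

Lemma weightU (E F G : {set arrow Q}) : (forall d, d \in E = (d \in F) || (d \in G)) ->
  (forall d, d \in F -> d \notin G) ->
  (forall T, T \in Ts -> T \subset E -> T \subset F \/ T \subset G) ->
  weight E = weight F + weight G.
Proof.
move=> EFG FG TFG.
rewrite (@weight_partition _ [set: bool] (fun b => if b then F else G)).
- by rewrite (eq_bigl xpredT) ?big_bool // => b; rewrite inE.
- move=> d; rewrite EFG; split=> [/orP[]|[[] _ ->]]; rewrite ?orbT //.
    by exists true.
  by exists false.
- by move=> [] [] d _ _ //= dF dG; move: (FG d); rewrite dF dG => /(_ isT).
- by move=> T /TFG h /h[]; [exists true | exists false].
Qed.

Lemma weight0 : weight set0 = 0.
Proof.
rewrite (@weight_partition _ set0 (fun i : bool => set0)) ?big_set0 //.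
- by move=> d; rewrite inE; split=> // -[i]; rewrite inE.
- by move=> i j d; rewrite inE.
- by move=> T /Ts_3cycle/oriented_3cycle_neq0/negbTE TT; rewrite subset0 TT.
Qed.

(* Makes [weight] on [F] and its subsets independent of the rest of the quiver. *)
Definition isolated (F : {set arrow Q}) : Prop :=
  (forall T, T \in Ts -> forall d, d \in T -> d \in F -> T \subset F) /\
  (forall T, oriented_3cycle T -> T \subset F -> T \in Ts).

Lemma weight_arrow (d : arrow Q) : ~~ covered d -> weight [set d] = 1.
Proof.
move=> nd; rewrite /weight.
have -> : [set e in [set d] | ~~ covered e] = [set d].
  by apply/setP => e; rewrite !inE; case: eqP => //= ->.
have -> : [set T in Ts | T \subset [set d]] = set0; last by rewrite cards1 cards0.
apply/setP => T; rewrite !inE; apply/negP => /andP[TT Td].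
have /set0Pn[e eT] := oriented_3cycle_neq0 (Ts_3cycle TT).
have /set1P ed := subsetP Td _ eT; subst e.
by case/negP: nd; apply/existsP; exists T; rewrite TT.
Qed.

Lemma oriented_3cycle_card (T : {set arrow Q}) : oriented_3cycle T -> #|T| = 3.
Proof.
move=> /existsP[a /existsP[b /existsP[c /and4P[/eqP -> /eqP ab /eqP bc /eqP ca]]]].
have ne (d e : arrow Q) : tgt d = src e -> d != e.
  by move=> de; apply/eqP => h; move: de; rewrite h => /esym /no_loops.
by rewrite -setUA !cardsU1 cards1 !inE negb_or (ne _ _ ab) (ne _ _ bc) eq_sym (ne _ _ ca).
Qed.

Lemma weight_3cycle (T : {set arrow Q}) : T \in Ts -> weight T = 2.
Proof.
move=> TT; rewrite /weight.
have -> : [set e in T | ~~ covered e] = set0.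
  apply/setP => e; rewrite !inE; apply/negP => /andP[eT /negP]; apply.
  by apply/existsP; exists T; rewrite TT.
have -> : [set T' in Ts | T' \subset T] = [set T]; last by rewrite cards1 cards0.
apply/setP => T'; rewrite !inE; apply/andP/eqP => [[T'T TT']|->//].
by apply/eqP; rewrite eqEcard TT' !oriented_3cycle_card //; apply: Ts_3cycle.
Qed.

End Weight.

(** The vertex [o] is the only gate of [A]. If the third vertex lay outside, both ends of [e] would
    have to be this gate and [e] would be a loop. *)
Lemma oriented_3cycle_inside (Q : quiver) (T : {set arrow Q}) (A : {pred vert Q})
    (o : option (vert Q)) (e : arrow Q) :
  oriented_3cycle T ->
  {in T, forall d, src d \in A -> tgt d \notin A -> o = Some (src d)} ->
  {in T, forall d, tgt d \in A -> src d \notin A -> o = Some (tgt d)} ->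
  e \in T -> src e \in A -> tgt e \in A ->
  {in T, forall d, (src d \in A) && (tgt d \in A)}.
Proof.
move=> T3 Ts Tt eT se te.
have [f [g [TE ef fg ge]]] := oriented_3cycle_rot T3 eT.
have fT : f \in T by rewrite TE !inE eqxx orbT.
have gT : g \in T by rewrite TE !inE eqxx orbT.
have tf : tgt f \in A.
  apply: contraT => tf; have := Ts f fT; rewrite -ef => /(_ te tf) oE.
  have := Tt g gT; rewrite ge -fg => /(_ se tf); rewrite oE => -[/esym].
  by move/no_loops.
by move=> d; rewrite TE !inE -orbA => /or3P[]/eqP->; rewrite ?se ?te ?ge -?ef -?fg ?te ?se ?tf.
Qed.

Definition tree_arrows (Q : quiver) (t : tree (vert Q)) : {set arrow Q} :=
  arrows_in [set x in labels t].

Lemma tree_arrowsE (Q : quiver) (t : tree (vert Q)) d :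
  (d \in tree_arrows t) = (src d \in labels t) && (tgt d \in labels t).
Proof. by rewrite !inE. Qed.

Section NodeArrows.
Variables (Q : quiver) (v : vert Q) (l r : tree (vert Q)).
Hypothesis vlr : realized (Node v l r).

Let u : uniq (labels (Node v l r)). Proof. by case: vlr. Qed.
Let vl : v \notin labels l.
Proof. by move: u; rewrite /= mem_cat negb_or -andbA => /and3P[]. Qed.
Let vr : v \notin labels r.
Proof. by move: u; rewrite /= mem_cat negb_or -andbA => /and3P[]. Qed.
Let lr x : x \in labels l -> x \notin labels r.
Proof.
move: u => /= /andP[_]; rewrite cat_uniq => /and3P[_ /hasPn h _] xl.
by apply/negP => /h/negP; apply.
Qed.

Definition node_arrows : {set arrow Q} :=
  [set d in tree_arrows (Node v l r) | (d \notin tree_arrows l) && (d \notin tree_arrows r)].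

Lemma node_arrowsP d : d \in node_arrows ->
  [\/ src d = v /\ root l = Some (tgt d), root l = Some (src d) /\ root r = Some (tgt d)
    | root r = Some (src d) /\ tgt d = v].
Proof.
rewrite inE !tree_arrowsE => /and3P[/andP[st tt] nl nr].
have : 0 < narrows (src d) (tgt d) by apply/narrows_gt0P; exists d.
rewrite (proj2 vlr) //= !tris_narrowsE.
have -> : tris_narrows (tris l) (src d) (tgt d) = 0.
  by apply/eqP; rewrite -leqn0 leqNgt; apply: contra nl => /tris_narrows_gt0[-> ->].
have -> : tris_narrows (tris r) (src d) (tgt d) = 0.
  by apply/eqP; rewrite -leqn0 leqNgt; apply: contra nr => /tris_narrows_gt0[-> ->].
rewrite /tri_narrows /= !addn0 !addn_gt0 !lt0b -orbA.
by case/or3P => /andP[/eqP s /eqP t];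
  [apply: Or31; case: s | apply: Or32 | apply: Or33; case: t].
Qed.

(** The subtree [l] meets the top triangle only in its root, which is the gate required by
    [oriented_3cycle_inside]. *)
Lemma node_arrows_left d : d \in tree_arrows (Node v l r) ->
  (src d \in labels l -> tgt d \notin labels l -> root l = Some (src d)) /\
  (tgt d \in labels l -> src d \notin labels l -> root l = Some (tgt d)).
Proof.
move=> dt; split=> sl tl.
  have /node_arrowsP[[sv _]|[//]|[/root_labels sr _]] : d \in node_arrows.
  - by rewrite inE dt !tree_arrowsE (negbTE tl) (negbTE (lr sl)) andbF.
  - by move: vl; rewrite -sv sl.
  - by move: (lr sl); rewrite sr.
have /node_arrowsP[[//]|[_ /root_labels tr]|[_ tv]] : d \in node_arrows.
- by rewrite inE dt !tree_arrowsE (negbTE tl) (negbTE (lr sl)) andbF.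
- by move: (lr sl); rewrite tr.
- by move: vl; rewrite -tv sl.
Qed.

Lemma node_arrows_right d : d \in tree_arrows (Node v l r) ->
  (src d \in labels r -> tgt d \notin labels r -> root r = Some (src d)) /\
  (tgt d \in labels r -> src d \notin labels r -> root r = Some (tgt d)).
Proof.
have rl x : x \in labels r -> (x \in labels l) = false.
  by move=> xr; apply/negP => /lr; rewrite xr.
move=> dt; split=> sl tl.
  have /node_arrowsP[[sv _]|[/root_labels]|[//]] : d \in node_arrows.
  - by rewrite inE dt !tree_arrowsE (negbTE tl) (rl _ sl) andbF.
  - by move: vr; rewrite -sv sl.
  - by rewrite rl.
have /node_arrowsP[[_ /root_labels]|[//]|[_ tv]] : d \in node_arrows.
- by rewrite inE dt !tree_arrowsE (negbTE tl) (rl _ sl) !andbF.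
- by rewrite rl.
- by move: vr; rewrite -tv sl.
Qed.

Lemma tree_arrows_left : tree_arrows l \subset tree_arrows (Node v l r).
Proof.
by apply/subsetP => d; rewrite !tree_arrowsE /= !inE !mem_cat => /andP[-> ->]; rewrite !orbT.
Qed.

Lemma tree_arrows_right : tree_arrows r \subset tree_arrows (Node v l r).
Proof.
by apply/subsetP => d; rewrite !tree_arrowsE /= !inE !mem_cat => /andP[-> ->]; rewrite !orbT.
Qed.

Lemma oriented_3cycle_left T d : oriented_3cycle T -> T \subset tree_arrows (Node v l r) ->
  d \in T -> d \in tree_arrows l -> T \subset tree_arrows l.
Proof.
move=> T3 Tt dT; rewrite tree_arrowsE => /andP[sd td].
apply/subsetP => e eT; rewrite tree_arrowsE.
apply: (oriented_3cycle_inside T3 (o := root l) _ _ dT sd td eT) => f fT.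
  by case: (node_arrows_left (subsetP Tt _ fT)).
by case: (node_arrows_left (subsetP Tt _ fT)).
Qed.

Lemma oriented_3cycle_right T d : oriented_3cycle T -> T \subset tree_arrows (Node v l r) ->
  d \in T -> d \in tree_arrows r -> T \subset tree_arrows r.
Proof.
move=> T3 Tt dT; rewrite tree_arrowsE => /andP[sd td].
apply/subsetP => e eT; rewrite tree_arrowsE.
apply: (oriented_3cycle_inside T3 (o := root r) _ _ dT sd td eT) => f fT.
  by case: (node_arrows_right (subsetP Tt _ fT)).
by case: (node_arrows_right (subsetP Tt _ fT)).
Qed.

Lemma oriented_3cycle_node T : oriented_3cycle T -> T \subset tree_arrows (Node v l r) ->
  [\/ T \subset node_arrows, T \subset tree_arrows l | T \subset tree_arrows r].
Proof.
move=> T3 Tt.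
have [/existsP[d /andP[dT dl]]|/existsPn nl] := boolP [exists d,
  (d \in T) && (d \in tree_arrows l)].
  by apply: Or32; exact: oriented_3cycle_left dl.
have [/existsP[d /andP[dT dr]]|/existsPn nr] := boolP [exists d,
  (d \in T) && (d \in tree_arrows r)].
  by apply: Or33; exact: oriented_3cycle_right dr.
apply: Or31; apply/subsetP => d dT; move: (nl d) (nr d).
by rewrite dT /= => nld nrd; rewrite inE (subsetP Tt) // nld nrd.
Qed.

(** No triangle of a subtree contains two sides of the top triangle, so the arrows of the latter
    have multiplicity one. *)
Lemma unique_root_arrow x y :
  [|| (x == v) && (root l == Some y), (root l == Some x) && (root r == Some y)
    | (root r == Some x) && (y == v)] ->
  exists d, [/\ src d = x, tgt d = y &
    forall d', src d' = x -> tgt d' = y -> d' = d].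
Proof.
move=> h; suff /eqP/cards1P[d dE] : narrows x y = 1.
  have := set11 d; rewrite -dE inE => /andP[/eqP sd /eqP td].
  exists d; split=> // d' sd' td'; apply/set1P; rewrite -dE inE sd' td' !eqxx //.
have vS o : (Some v == Some o) = (o == v) by rewrite eq_sym.
have vl' z : root l == Some z -> (z == v) = false.
  by move=> /eqP/root_labels; apply: contraTF => /eqP->.
have vr' z : root r == Some z -> (z == v) = false.
  by move=> /eqP/root_labels; apply: contraTF => /eqP->.
have rootl z : root l == Some z -> z \in labels l by move=> /eqP/root_labels.
have rootr z : root r == Some z -> z \in labels r by move=> /eqP/root_labels.
have ml : v \in labels (Node v l r) by exact: mem_head.
have inl z : z \in labels l -> z \in labels (Node v l r).
  by rewrite /= !inE mem_cat => ->; rewrite !orbT.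
have inr z : z \in labels r -> z \in labels (Node v l r).
  by rewrite /= !inE mem_cat => ->; rewrite !orbT.
case/or3P: h => /andP[hx hy].
- rewrite (eqP hx) (proj2 vlr _ _ ml (inl _ (rootl _ hy))) /= !tris_narrowsE.
  rewrite (tris_narrows0l _ vl) (tris_narrows0l _ vr) /tri_narrows /= hy eqxx.
  by rewrite ?(root_labelsF vl) ?(root_labelsF vr) ?vS ?(vl' _ hy) ?andbF.
- rewrite (proj2 vlr _ _ (inl _ (rootl _ hx)) (inr _ (rootr _ hy))) /= !tris_narrowsE.
  rewrite (tris_narrows0l _ (lr (rootl _ hx))) [tris_narrows (tris l) _ _]tris_narrows0r ?hy.
    by rewrite /tri_narrows /= hx hy !vS (vl' _ hx) (vr' _ hy) !andbF.
  by apply/negP => /lr; rewrite rootr.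
- rewrite (eqP hy) (proj2 vlr _ _ (inr _ (rootr _ hx)) ml) /= !tris_narrowsE.
  rewrite (tris_narrows0r _ vl) (tris_narrows0r _ vr) /tri_narrows /= hx eqxx.
  by rewrite ?(root_labelsF vl) ?(root_labelsF vr) ?vS ?(vr' _ hx) ?andbF.
Qed.

End NodeArrows.

Section TreeWeight.
Variables (Q : quiver) (Ts : {set {set arrow Q}}).
Hypothesis Ts_3cycle : forall T, T \in Ts -> oriented_3cycle T.

Lemma isolated_left (v : vert Q) l r : realized (Node v l r) ->
  isolated Ts (tree_arrows (Node v l r)) -> isolated Ts (tree_arrows l).
Proof.
move=> R [iN Ni]; split=> [T TT d dT dl|T T3 Tl].
  apply: (oriented_3cycle_left R _ _ dT dl); first exact: Ts_3cycle.
  by apply: iN dT _ => //; apply: subsetP dl; exact: tree_arrows_left.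
by apply: Ni => //; apply: subset_trans Tl (tree_arrows_left _ _ _).
Qed.

Lemma isolated_right (v : vert Q) l r : realized (Node v l r) ->
  isolated Ts (tree_arrows (Node v l r)) -> isolated Ts (tree_arrows r).
Proof.
move=> R [iN Ni]; split=> [T TT d dT dl|T T3 Tl].
  apply: (oriented_3cycle_right R _ _ dT dl); first exact: Ts_3cycle.
  by apply: iN dT _ => //; apply: subsetP dl; exact: tree_arrows_right.
by apply: Ni => //; apply: subset_trans Tl (tree_arrows_right _ _ _).
Qed.

(** With two children the three arrows form a 3-cycle, which belongs to [Ts] by isolation and weighs
    2. With one child there is a single uncovered arrow. The right-hand side is the number of tree
    edges going down from [v]. *)
Lemma weight_node_arrows (v : vert Q) l r : realized (Node v l r) ->
  isolated Ts (tree_arrows (Node v l r)) ->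
  weight Ts (node_arrows v l r) = (root l != None) + (root r != None).
Proof.
move=> R [iN Ni].
have in_node d : d \in node_arrows v l r ->
    [/\ d \in tree_arrows (Node v l r), d \notin tree_arrows l & d \notin tree_arrows r].
  by rewrite inE => /and3P[].
have inE3 d : [|| (src d == v) && (root l == Some (tgt d)),
      (root l == Some (src d)) && (root r == Some (tgt d))
    | (root r == Some (src d)) && (tgt d == v)] -> d \in node_arrows v l r.
  have := R.1 => /= /andP[];
    rewrite mem_cat negb_or cat_uniq => /andP[vl vr] /and3P[_ /hasPn lr _].
  have rl x : x \in labels l -> x \notin labels r by move=> xl; apply/negP => /lr/negP; apply.
  move=> h; rewrite inE !tree_arrowsE /= !inE !mem_cat.
  case/or3P: h => /andP[/eqP s /eqP t].
  - by rewrite s (root_labels t) eqxx (negbTE vl) (negbTE vr) orbT.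
  - rewrite (root_labels s) (root_labels t) (negbTE (rl _ (root_labels s))) /= !orbT /= andbT.
    by apply: lr (root_labels t).
  - by rewrite t (root_labels s) eqxx (negbTE vl) (negbTE vr) !andbF !orbT.
(* By isolation a 3-cycle through [d] would lie among the arrows of the top triangle, where [d] is
   alone. *)
have cov1 d : node_arrows v l r = [set d] -> ~~ covered Ts d.
  move=> dE; apply/existsP => -[T /andP[TT dT]].
  have dK : d \in node_arrows v l r by rewrite dE set11.
  have [dt nl nr] := in_node _ dK; have T3 := Ts_3cycle TT.
  have [TK|/subsetP/(_ _ dT)|/subsetP/(_ _ dT)] := oriented_3cycle_node R T3 (iN _ TT _ dT dt).
  - by have := subset_leq_card TK; rewrite oriented_3cycle_card // dE cards1.
  - by rewrite (negbTE nl).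
  - by rewrite (negbTE nr).
case lE : (root l) => [y|]; case rE : (root r) => [z|] /=.
- have [|d1 [s1 t1 d1U]] := @unique_root_arrow _ _ _ _ R v y; first by rewrite lE !eqxx.
  have [|d2 [s2 t2 d2U]] := @unique_root_arrow _ _ _ _ R y z; first by rewrite lE rE !eqxx orbT.
  have [|d3 [s3 t3 d3U]] := @unique_root_arrow _ _ _ _ R z v; first by rewrite rE !eqxx !orbT.
  have KE : node_arrows v l r = [set d1; d2; d3].
    apply/eqP; rewrite eqEsubset; apply/andP; split; apply/subsetP => d.
      move=> dK; have := node_arrowsP R dK; rewrite !inE -orbA => h; apply/or3P; move: h.
      rewrite lE rE => -[[sd [td]]|[[sd] [td]]|[[sd] td]].
      + by apply: Or31; apply/eqP; apply: d1U.
      + by apply: Or32; apply/eqP; apply: d2U.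
      + by apply: Or33; apply/eqP; apply: d3U.
    rewrite !(in_setU, in_set1) -orbA => /or3P[]/eqP->; apply: inE3.
    + by rewrite s1 t1 lE !eqxx.
    + by rewrite s2 t2 lE rE !eqxx !orbT.
    + by rewrite s3 t3 rE !eqxx !orbT.
  have T3 : oriented_3cycle [set d1; d2; d3].
    apply/existsP; exists d1; apply/existsP; exists d2; apply/existsP; exists d3.
    by rewrite s1 s2 s3 t1 t2 t3 !eqxx.
  rewrite KE weight_3cycle //; apply: Ni => //; rewrite -KE.
  by apply/subsetP => d /in_node[].
- have [|d [sd td dU]] := @unique_root_arrow _ _ _ _ R v y; first by rewrite lE !eqxx.
  have KE : node_arrows v l r = [set d].
    apply/setP => e; rewrite [in RHS]inE; apply/idP/eqP => [/(node_arrowsP R)|->].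
      by rewrite lE rE => -[[se [te]]|[]|[]] //; apply: dU.
    by apply: inE3; rewrite sd td lE !eqxx.
  by rewrite KE weight_arrow // cov1.
- have [|d [sd td dU]] := @unique_root_arrow _ _ _ _ R z v; first by rewrite rE !eqxx !orbT.
  have KE : node_arrows v l r = [set d].
    apply/setP => e; rewrite [in RHS]inE; apply/idP/eqP => [/(node_arrowsP R)|->].
      by rewrite lE rE => -[[]|[]|[[se] te]] //; apply: dU.
    by apply: inE3; rewrite sd td rE !eqxx !orbT.
  by rewrite KE weight_arrow // cov1.
- have -> : node_arrows v l r = set0; last exact: weight0.
  apply/setP => e; rewrite [in RHS]inE; apply/negP => /(node_arrowsP R).
  by rewrite lE rE => -[[]|[]|[]].
Qed.

(** The weight is the number of edges of the tree, one less than its number of nodes; the correction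
    vanishes for the empty tree. *)
Lemma weight_tree (t : tree (vert Q)) : realized t -> isolated Ts (tree_arrows t) ->
  weight Ts (tree_arrows t) + (root t != None) = size (labels t).
Proof.
elim: t => [|v l IHl r IHr] R iN.
  have -> : tree_arrows Leaf = set0 :> {set arrow Q}.
    by apply/setP => d; rewrite tree_arrowsE inE.
  by rewrite weight0.
have il := isolated_left R iN; have ir := isolated_right R iN.
have Rl := realized_left R; have Rr := realized_right R.
rewrite /= size_cat -(IHl Rl il) -(IHr Rr ir).
have rl d : d \in tree_arrows l -> d \in tree_arrows r -> false.
  rewrite !tree_arrowsE => /andP[sl _] /andP[sr _].
  have := R.1 => /= /andP[_]; rewrite cat_uniq => /and3P[_ /hasPn/(_ _ sr)/negP[]]; exact: sl.

rewrite (@weightU _ _ Ts_3cycle (tree_arrows (Node v l r)) (node_arrows v l r) (tree_arrows l :|: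
  tree_arrows r)).
- rewrite (@weightU _ _ Ts_3cycle (tree_arrows l :|: tree_arrows r) (tree_arrows l) (tree_arrows
  r)).
  + by rewrite (weight_node_arrows R iN) addn1; lia.
  + by move=> d; rewrite in_setU.
  + by move=> d dl; apply/negP => /(rl _ dl).
  + move=> T TT TU; have T3 := Ts_3cycle TT.
    have Tt : T \subset tree_arrows (Node v l r).
      apply: subset_trans TU _; rewrite subUset tree_arrows_left.
      exact: tree_arrows_right.
    case: (oriented_3cycle_node R T3 Tt); [|by left|by right].
    have /set0Pn[d dT] := oriented_3cycle_neq0 T3.
    move=> /subsetP/(_ _ dT); rewrite inE => /and3P[_ nl nr].
    by have := subsetP TU _ dT; rewrite in_setU (negbTE nl) (negbTE nr).
- move=> d; rewrite in_setU; apply/idP/or3P => [dt|[|dl|dr]].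
  + have [dl|nl] := boolP (d \in tree_arrows l); first exact: Or32.
    have [dr|nr] := boolP (d \in tree_arrows r); first exact: Or33.
    by apply: Or31; rewrite inE dt nl nr.
  + by rewrite inE => /andP[].
  + exact: subsetP (tree_arrows_left _ _ _) _ dl.
  + exact: subsetP (tree_arrows_right _ _ _) _ dr.
- by move=> d; rewrite inE in_setU negb_or => /andP[].
- move=> T TT Tt; have T3 := Ts_3cycle TT.
  case: (oriented_3cycle_node R T3 Tt) => TF; [by left| |]; right.
    by apply: subset_trans TF _; rewrite subsetUl.
  by apply: subset_trans TF _; rewrite subsetUr.
Qed.

End TreeWeight.

(** * The class Q_n *)

Section Blocks.
Variables (Q : quiver) (S : {set vert Q}) (tri : arrow Q -> option (arrow Q * arrow Q)).
Variable U : arrow Q -> {set vert Q}.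
Hypothesis H : Qn_structure S tri U.

Let U_notin_S a x : x \in U a -> x \notin S.
Proof. by move=> xU; apply/(Qn_U_cover H); exists a. Qed.

Let U_inj a a' x : x \in U a -> x \in U a' -> a = a'.
Proof.
move=> xa xa'; apply/eqP/negPn/negP => /eqP/(Qn_U_disjoint H)/pred0P/(_ x) /=.
by rewrite xa xa'.
Qed.

Let U_arrow a d : src d \notin S -> tgt d \notin S -> (src d \in U a) || (tgt d \in U a) ->
  d \in arrows_in (U a).
Proof.
move=> ds dt; have [a'] := Qn_U_arrows H ds dt; rewrite !inE => /andP[sa ta].
by case/orP => [/(U_inj sa)|/(U_inj ta)] <-; rewrite sa ta.
Qed.

Let U_tri a x : x \in U a -> exists b c, tri a = Some (b, c).
Proof.
case E: (tri a) => [[b c]|] xU; first by exists b, c.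
by move: xU; rewrite (Qn_U0 H E) inE.
Qed.

Let U_S a x : x \in U a -> a \in arrows_in S.
Proof. by case/U_tri => b [c /(Qn_tri H)[]]. Qed.

(** All arrows of the glued piece at [a]: the other two arrows of the chosen 3-cycle have an end at
    [z_a], which lies in [U a]. Stated by endpoints, this covers the case without [z_a] as well. *)
Definition block (a : arrow Q) : {set arrow Q} :=
  [set d | [|| d == a, src d \in U a | tgt d \in U a]].

Lemma blockP a d : d \in block a ->
  [\/ d = a, exists b c, tri a = Some (b, c) /\ (d = b \/ d = c) | d \in arrows_in (U a)].
Proof.
rewrite inE => /orP[/eqP|dU]; first exact: Or31.
have [dS|dS] := boolP ((src d \in S) || (tgt d \in S)); last first.
  by move: dS; rewrite negb_or => /andP[ds dt]; apply: Or33; exact: U_arrow.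
case: (Qn_no_other_arrows H dS) => [|[a' [b [c [E dbc]]]]].
  by rewrite inE => /andP[ds dt]; case/orP: dU => /U_notin_S; rewrite ?ds ?dt.
have [a'S _ [ab bc ca]] := Qn_tri H E; have [bU _ _] := Qn_root H E.
move: a'S; rewrite inE => /andP[sa ta]; apply: Or32.
suff <- : a' = a by exists b, c.
case: dbc dU => ->.
  by rewrite -ab => /orP[/U_notin_S|/(U_inj bU)//]; rewrite ta.
by rewrite -bc ca => /orP[/(U_inj bU)//|/U_notin_S]; rewrite sa.
Qed.

Lemma block_cover d : exists2 a, a \in arrows_in S & d \in block a.
Proof.
have [dS|] := boolP (d \in arrows_in S); first by exists d; rewrite // inE eqxx.
rewrite inE negb_and => /orP[] /(Qn_U_cover H)[a aU];
  by exists a; [exact: U_S aU | rewrite inE aU ?orbT].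
Qed.

Lemma block_inj a a' d : a \in arrows_in S -> a' \in arrows_in S ->
  d \in block a -> d \in block a' -> a = a'.
Proof.
have blockS b : d \in arrows_in S -> d \in block b -> d = b.
  rewrite !inE => /andP[sd td] /or3P[/eqP//|/U_notin_S|/U_notin_S].
    by rewrite sd.
  by rewrite td.
move=> aS a'S; have [dS|dS] := boolP (d \in arrows_in S).
  by move=> /(blockS _ dS) <- /(blockS _ dS).
rewrite !inE; have [E|_] := eqVneq d a; first by rewrite E aS in dS.
have [E|_] := eqVneq d a'; first by rewrite E a'S in dS.
move=> /= /orP h /orP h'; case: h => h; case: h' => h'; try exact: U_inj h h'.
  have := U_arrow (U_notin_S h) (U_notin_S h'); move/(_ a); rewrite h => /(_ isT).
  by rewrite inE => /andP[_ /U_inj]; apply.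
have := U_arrow (U_notin_S h') (U_notin_S h); move/(_ a'); rewrite h' => /(_ isT).
by rewrite inE => /andP[_ /(U_inj h)].
Qed.

Lemma tri_notin_S a b c : tri a = Some (b, c) -> (b \notin arrows_in S) && (c \notin arrows_in S).
Proof. by case/(Qn_tri H) => _ bS [_ bc _]; rewrite !inE -bc (negbTE bS) andbF. Qed.

Lemma tri_notin_U a a' b c : tri a = Some (b, c) ->
  [&& a \notin arrows_in (U a'), b \notin arrows_in (U a') & c \notin arrows_in (U a')].
Proof.
case/(Qn_tri H) => aS _ [ab _ ca]; move: aS; rewrite inE => /andP[sa ta].
have SU x : x \in S -> (x \in U a') = false by move=> xS; apply/negP => /U_notin_S; rewrite xS.
by rewrite !inE -ab ca (SU _ sa) (SU _ ta) !andbF.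
Qed.

Lemma block_tri a b c : tri a = Some (b, c) ->
  block a = a |: (b |: (c |: arrows_in (U a))).
Proof.
move=> E; apply/setP => d; have [aS _ [ab bc ca]] := Qn_tri H E; have [bU _ _] := Qn_root H E.
apply/idP/idP => [/blockP[->|[b' [c' []]]|dU]|].
- by rewrite !in_setU1 eqxx.
- by rewrite E => -[<- <-] [] ->; rewrite !in_setU1 eqxx ?orbT.
- by rewrite !in_setU1 dU !orbT.
rewrite !in_setU1 => /or4P[/eqP->|/eqP->|/eqP->|]; rewrite !inE ?eqxx //.
- by rewrite bU !orbT.
- by rewrite -bc bU !orbT.
- by move=> /andP[->]; rewrite orbT.
Qed.

Lemma block0 a : tri a = None -> block a = [set a].
Proof. by move=> E; apply/setP => d; rewrite !inE (Qn_U0 H E) !inE !orbF. Qed.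

Local Notation Ts := (three_cycles S tri).

Lemma three_cycles_3cycle T : T \in Ts -> oriented_3cycle T.
Proof. by rewrite inE => /andP[]. Qed.

Lemma three_cyclesS T d : T \in Ts -> d \in T -> d \in arrows_in S ->
  exists b c, tri d = Some (b, c) /\ T = [set d; b; c].
Proof.
rewrite inE => /andP[_ /forallP/(_ d)] + dT dS; rewrite inE dT dS /=.
by case: (tri d) => // -[b c] /eqP; exists b, c.
Qed.

Lemma three_cycles_tri a b c : tri a = Some (b, c) -> [set a; b; c] \in Ts.
Proof.
move=> E; have [aS _ [ab bc ca]] := Qn_tri H E; rewrite inE; apply/andP; split.
  apply/existsP; exists a; apply/existsP; exists b; apply/existsP; exists c.
  by rewrite ab bc ca !eqxx.
apply/forallP => d; apply/implyP => /setIP[]; rewrite !in_setU !in_set1 -orbA.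
have /andP[/negP bS /negP cS] := tri_notin_S E.
by case/or3P => /eqP-> // _; rewrite E.
Qed.

Lemma three_cyclesP T : T \in Ts ->
  (exists a b c, tri a = Some (b, c) /\ T = [set a; b; c]) \/
  exists a, T \subset arrows_in (U a).
Proof.
move=> TT; have T3 := three_cycles_3cycle TT.
have [/existsP[d /andP[dT dS]]|/existsPn nS] := boolP [exists d,
  (d \in T) && (d \in arrows_in S)].
  by left; have [b [c [E TE]]] := three_cyclesS TT dT dS; exists d, b, c.
right; have {}nS d : d \in T -> d \notin arrows_in S.
  by move=> dT; have := nS d; rewrite dT.
(* If [f] leaves [U a], it ends on the non-oriented cycle. The next arrow of [T] then has to enter
   some [U a'] at its root, and the third one runs from this root back into [U a]. Hence [a' = a],
   and the third arrow is a loop at [z_a]. *)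
have step a f : f \in T -> src f \in U a -> tgt f \in U a.
  move=> fT fU; have [g [h [TE fg gh hf]]] := oriented_3cycle_rot T3 fT.
  have /blockP[fa|[b [c [E fbc]]]|] : f \in block a by rewrite inE fU orbT.
  - by have := nS _ fT; rewrite fa (U_S fU).
  - have [aS _ [ab bc ca]] := Qn_tri H E; have [bU _ _] := Qn_root H E.
    move: aS; rewrite inE => /andP[sa ta].
    case: fbc => fE; first by have := U_notin_S fU; rewrite fE -ab ta.
    have gT : g \in T by rewrite TE !inE eqxx orbT.
    have [a' a'S gB] := block_cover g.
    have /blockP[ga|[b' [c' [E' gbc]]]|] := gB.
    + by have := nS _ gT; rewrite ga a'S.
    + have [_ b'S [a'b' b'c' c'a']] := Qn_tri H E'; have [b'U _ _] := Qn_root H E'.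
      case: gbc => gE; last by move: b'S; rewrite b'c' -gE -fg fE ca sa.
      have hS : src h \notin S by rewrite -gh gE.
      have : h \in arrows_in (U a).
        by apply: U_arrow => //; rewrite hf ?(U_notin_S fU) // fU orbT.
      rewrite inE -gh gE => /andP[/(U_inj b'U) aa' _]; subst a'.
      move: E'; rewrite E => -[bb' _].
      by case: (@no_loops _ h); rewrite -gh gE -bb' hf fE bc.
    + by rewrite inE -fg fE ca => /andP[/U_notin_S]; rewrite sa.
  - by rewrite inE => /andP[].
have /set0Pn[e eT] := oriented_3cycle_neq0 T3.
have [g [h [TE eg gh he]]] := oriented_3cycle_rot T3 eT.
have gT : g \in T by rewrite TE !inE eqxx orbT.
have hT : h \in T by rewrite TE !inE eqxx !orbT.
have allin a : src e \in U a -> T \subset arrows_in (U a).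
  move=> eU; have gU := step _ _ eT eU; rewrite eg in gU.
  have hU := step _ _ gT gU; rewrite gh in hU.
  by apply/subsetP => d; rewrite TE !inE -orbA => /or3P[]/eqP->; rewrite ?eg ?gh ?he ?eU ?gU ?hU.
have [a aS /blockP[ea|[b [c [E ebc]]]|]] := block_cover e.
- by have := nS _ eT; rewrite ea aS.
- have [bU _ _] := Qn_root H E; have [_ _ [ab bc ca]] := Qn_tri H E.
  exists a; apply: allin; case: ebc => eE; last by rewrite eE -bc.
  by rewrite -he; apply: (step a) => //; rewrite -gh; apply: (step a) => //; rewrite -eg eE.
- by rewrite inE => /andP[eU _]; exists a; apply: allin.
Qed.

Lemma isolated_U a : isolated Ts (arrows_in (U a)).
Proof.
split=> [T TT d dT dU|T T3 TU].
  have [[a' [b [c [E TE]]]]|[a' Ta']] := three_cyclesP TT.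
    have /and3P[] := tri_notin_U a E; move: dT; rewrite TE !(in_setU, in_set1) -orbA.
    by case/or3P => /eqP dE; rewrite -dE dU.
  suff <- : a' = a by [].
  have := subsetP Ta' _ dT; rewrite inE => /andP[sa _].
  by move: dU; rewrite inE => /andP[/(U_inj sa)].
rewrite inE T3; apply/forallP => d; apply/implyP => /setIP[/(subsetP TU)].
by rewrite !inE => /andP[/U_notin_S/negP + _] /andP[].
Qed.

(** The chosen 3-cycle weighs 2 and the tree [#|U a| - 1]. Without [z_a] only the uncovered arrow
    [a] remains. *)
Lemma weight_block a : a \in arrows_in S ->
  (forall b c, tri a = Some (b, c) ->
    exists t, [/\ realized t, labels t =i U a & root t = Some (tgt b)]) ->
  weight Ts (block a) = 1 + #|U a|.
Proof.
have Ts3 := three_cycles_3cycle.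
move=> aS; case E: (tri a) => [[b c]|] h.
  have [t [R tU rt]] := h _ _ erefl.
  have tE : arrows_in (U a) = tree_arrows t.
    by apply/setP => d; rewrite tree_arrowsE inE !tU.
  have -> : #|U a| = size (labels t).
    by rewrite -(card_uniqP R.1); apply: eq_card => x; rewrite tU.
  have isoU := isolated_U a; rewrite tE in isoU.
  rewrite -(weight_tree Ts3 R isoU) rt.
  rewrite (@weightU _ _ Ts3 _ [set a; b; c] (arrows_in (U a))).
  - by rewrite weight_3cycle ?three_cycles_tri // tE /=; lia.
  - by move=> d; rewrite (block_tri E) !(in_setU, in_set1) -!orbA.
  - move=> d; have /and3P[aU bU cU] := tri_notin_U a E.
    by rewrite !(in_setU, in_set1) -orbA => /or3P[]/eqP->.
  - move=> T TT TB; have [[a' [b' [c' [E' TE]]]]|[a' Ta']] := three_cyclesP TT.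
      left; suff aa' : a = a' by subst a'; move: E'; rewrite E TE => -[-> ->].
      have [a'S _ _] := Qn_tri H E'.
      apply: (block_inj aS a'S (d := a')); last by rewrite inE eqxx.
      by apply: (subsetP TB); rewrite TE !inE eqxx.
    right; suff aa' : a = a' by subst a'.
    have /set0Pn[d dT] := oriented_3cycle_neq0 (Ts3 _ TT).
    have := subsetP Ta' _ dT; rewrite inE => /andP[dU _].
    by apply: (block_inj aS (U_S dU) (subsetP TB _ dT)); rewrite inE dU orbT.
rewrite (Qn_U0 H E) cards0 (block0 E) weight_arrow //.
apply/existsP => -[T /andP[TT aT]].
by have [b [c []]] := three_cyclesS TT aT aS; rewrite E.
Qed.

(** Both parameters of one direction are read off the union of the blocks over [C], and no 3-cycle
    in [three_cycles S tri] runs through two blocks, so weights add up. *)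
Lemma param_weight (C : {set arrow Q}) : C \subset arrows_in S ->
  (forall a b c, tri a = Some (b, c) ->
    exists t, [/\ realized t, labels t =i U a & root t = Some (tgt b)]) ->
  param_arrows S tri U C + 2 * param_3cycles S tri U C = \sum_(a in C) (1 + #|U a|).
Proof.
move=> CS h; have Ts3 := three_cycles_3cycle.
pose E := [set d | [exists a in C, d \in block a]].
have EP d : d \in E <-> exists2 a, a \in C & d \in block a.
  by rewrite inE; split=> [/existsP[a /andP[aC da]]|[a aC da]]; [exists a | apply/existsP;
    exists a; rewrite aC].
transitivity (weight Ts E); last first.
  rewrite (@weight_partition _ _ Ts3 _ C block) //.
  - by apply: eq_bigr => a aC; apply: weight_block; [exact: subsetP aC | exact: h].
  - by move=> a a' d aC a'C; apply: block_inj; exact: subsetP CS _ _.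
  - move=> T TT TE.
    suff [a aS Ta] : exists2 a, a \in arrows_in S & T \subset block a.
      exists a => //; have /set0Pn[d dT] := oriented_3cycle_neq0 (Ts3 _ TT).
      have /EP[a' a'C da'] := subsetP TE _ dT.
      by rewrite (block_inj aS (subsetP CS _ a'C) (subsetP Ta _ dT) da').
    have [[a [b [c [Ea TEa]]]]|[a Ta]] := three_cyclesP TT.
      exists a; first by case: (Qn_tri H Ea).
      rewrite (block_tri Ea) TEa; apply/subsetP => d.
      by rewrite !(in_setU, in_set1) -orbA => /or3P[]->; rewrite ?orbT.
    have /set0Pn[d dT] := oriented_3cycle_neq0 (Ts3 _ TT).
    exists a; first by have := subsetP Ta _ dT; rewrite inE => /andP[/U_S].
    by apply: subset_trans Ta _; apply/subsetP => e; rewrite !inE => /andP[-> _]; rewrite orbT.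
rewrite /weight; congr (_ + 2 * _).
  apply: eq_card => d; rewrite [in LHS]inE [in RHS]inE andbC; apply: andb_id2r => nd.
  apply/idP/idP => [/orP[dC|/existsP[a /andP[aC dU]]]|/EP[a aC /blockP[->|[b [c [Ea dbc]]]|dU]]].
  - by apply/EP; exists d; rewrite // inE eqxx.
  - by apply/EP; exists a => //; move: dU; rewrite !inE => /andP[-> _]; rewrite orbT.
  - by rewrite aC.
  - case/negP: nd; apply/existsP; exists [set a; b; c]; rewrite three_cycles_tri //=.
    by case: dbc => ->; rewrite !inE eqxx ?orbT.
  - by apply/orP; right; apply/existsP; exists a; rewrite aC.
apply: eq_card => T; rewrite [in LHS]inE [in RHS]inE; apply: andb_id2l => TT.
have /set0Pn[d dT] := oriented_3cycle_neq0 (Ts3 _ TT).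
apply/existsP/idP => [[a /andP[aC /orP[aT|Ta]]]|TE].
- have [b [c [Ea TEa]]] := three_cyclesS TT aT (subsetP CS _ aC).
  apply/subsetP => e eT; apply/EP; exists a => //.
  rewrite (block_tri Ea); move: eT; rewrite TEa !(in_setU, in_set1) -orbA.
  by case/or3P => ->; rewrite ?orbT.
- apply/subsetP => e eT; apply/EP; exists a => //.
  by have := subsetP Ta _ eT; rewrite !inE => /andP[-> _]; rewrite orbT.
- have /EP[a' a'C da'] := subsetP TE _ dT.
  have [[a [b [c [Ea TEa]]]]|[a Ta]] := three_cyclesP TT.
    have aT : a \in T by rewrite TEa !inE eqxx.
    exists a; rewrite aT andbT; have /EP[a2 a2C] := subsetP TE _ aT.
    have [aS _ _] := Qn_tri H Ea.
    move=> /(block_inj aS (subsetP CS _ a2C)) -> //.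
    by rewrite inE eqxx.
  have := subsetP Ta _ dT; rewrite inE => /andP[dU _].
  exists a; rewrite Ta orbT andbT.
  by rewrite (block_inj (U_S dU) (subsetP CS _ a'C) _ da') // inE dU orbT.
Qed.

End Blocks.

Section BlockNarrows.
Variables (Q : quiver) (S : {set vert Q}) (tri : arrow Q -> option (arrow Q * arrow Q)).
Variables (U : arrow Q -> {set vert Q}) (t : arrow Q -> tree (vert Q)).
Hypothesis H : Qn_structure S tri U.
Hypothesis tP : forall a, [/\ realized (t a), labels (t a) =i U a
  & root (t a) = omap (fun bc => tgt bc.1) (tri a)].

(** Every arrow lies in exactly one block, and a block consists of the arrows of the glued triangle
    and those of the tree. The count is exact, without truncation. *)
Lemma narrows_blocks x y :
  narrows x y = \sum_(a in arrows_in S)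
    (tri_narrows (Some (src a), Some (tgt a), root (t a)) x y + tris_narrows (tris (t a)) x y).
Proof.
transitivity (\sum_(d in [set: arrow Q]) ((src d == x) && (tgt d == y))).
  by rewrite narrows_sum; apply: eq_bigl => d; rewrite inE.
rewrite (@sum_disjoint_union _ _ (arrows_in S) (block U)); first last.
- move=> a a' d; exact: (block_inj H).
- by move=> d; split=> // _; apply: (block_cover H).
apply: eq_bigr => a aS; have [R tU rt] := tP a.
case E: (tri a) rt => [[b c]|] /= rt; last first.
  rewrite (block0 H E) big_set1 tris_narrows0l; last by rewrite tU (Qn_U0 H E) inE.
  by rewrite /tri_narrows /= rt !andbF !addn0.
have [_ bS [ab bc ca]] := Qn_tri H E.
have /and3P[aU bU cU] := tri_notin_U H a E.
have Tc : oriented_3cycle [set a; b; c] by apply: (three_cycles_3cycle (three_cycles_tri H E)).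
have : #|[set a; b; c]| = 3 by apply: oriented_3cycle_card.
have -> : [set a; b; c] = a |: (b |: [set c]) by rewrite setUA.
rewrite !cardsU1 cards1 !in_setU1 !in_set1 => hc.
have [ab' ac'] : a \notin [:: b; c] /\ b != c.
  by move: hc; rewrite !inE; case: (a == b); case: (a == c); case: (b == c).
rewrite (block_tri H E) !big_setU1 /=; first last.
- by move: ab'; rewrite !in_setU1 !inE !negb_or => /andP[-> ->]; move: aU; rewrite inE.
- by move: bU; rewrite in_setU1 negb_or ac'.
- by [].
rewrite rt /tri_narrows /= -ab -bc ca -!addnA; do 3!congr (_ + _).
have tUE d : d \in arrows_in (U a) = (src d \in labels (t a)) && (tgt d \in labels (t a)).
  by rewrite inE !tU.
case: (boolP ((x \in labels (t a)) && (y \in labels (t a)))) => [/andP[xt yt]|nt].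
  rewrite -R.2 // narrows_sum [LHS]big_mkcond; apply: eq_bigr => d _; rewrite tUE.
  case: ifP => // /negP dt; apply/esym/eqP; rewrite eqb0; apply/negP => /andP[/eqP sx /eqP ty].
  by apply: dt; rewrite sx ty xt yt.
rewrite big1 => [|d]; last first.
  rewrite tUE => dt; apply/eqP; rewrite eqb0; apply: contra nt => /andP[/eqP <- /eqP <-] //.
by move: nt; rewrite negb_and => /orP[/tris_narrows0l->|/tris_narrows0r->].
Qed.

End BlockNarrows.

(** * Words *)

(* A step [(d, t, y)] of a walk around the cycle goes to [y] along a clockwise arrow iff [d];
   the tree [t] is glued to that arrow. *)
Notation step V := (bool * tree V * V)%type.

Definition step_tri (V : Type) (x : V) (s : step V) : triangle V :=
  if s.1.1 then (Some x, Some s.2, root s.1.2) else (Some s.2, Some x, root s.1.2).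

Fixpoint word_tris (V : Type) (x : V) (w : seq (step V)) : seq (triangle V) :=
  if w is s :: w' then step_tri x s :: tris s.1.2 ++ word_tris s.2 w' else [::].

(** The starting vertex is left out: in a closed word it comes back as the end of the last step. *)
Definition word_labels (V : Type) (w : seq (step V)) : seq V :=
  flatten [seq s.2 :: labels s.1.2 | s <- w].

Definition word_count (V : Type) (b : bool) (w : seq (step V)) : nat :=
  \sum_(s <- w | s.1.1 == b) (1 + size (labels s.1.2)).

Definition annular (Q : quiver) (x : vert Q) (w : seq (step (vert Q))) : Prop :=
  [/\ 1 < size w, last x [seq s.2 | s <- w] = x, uniq (word_labels w),
      forall y, y \in word_labels w & encodes (word_tris x w)].

Lemma tris_narrows_word (V : eqType) (v : nat -> V) (d : nat -> bool) (t : nat -> tree V) i m x y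
  :
  tris_narrows (word_tris (v i) [seq (d j, t j, v j.+1) | j <- iota i m]) x y =
  \sum_(i <= j < i + m) (tri_narrows (step_tri (v j) (d j, t j, v j.+1)) x y
                         + tris_narrows (tris (t j)) x y).
Proof.
elim: m i => [|m IHm] i; first by rewrite addn0 big_geq // tris_narrows_nil.
by rewrite big_ltn ?addnS ?ltnS ?leq_addr //= !tris_narrowsE IHm addSn addnA.
Qed.

Lemma has_parameters_annular (Q : quiver) (r1 r2 s1 s2 : nat) :
  has_parameters Q r1 r2 s1 s2 ->
  exists (x : vert Q) w, [/\ annular x w, word_count true w = s1 + 2 * s2 :> nat
    & word_count false w = r1 + 2 * r2].
Proof.
move=> [S [tri [U [m [v [e [H m2 [bv be ve] [-> ->] [-> ->]]]]]]]].
have tP a : exists t, [/\ realized t,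
  labels t =i U a & root t = omap (fun bc => tgt bc.1) (tri a)].
  case E: (tri a) => [[b c]|]; last first.
    by exists Leaf; split=> // x; rewrite (Qn_U0 H E) inE.
  have [bU i2 i3] := Qn_root H E; have [k _ /type_A_polygonal P] := Qn_type_A H E.
  by have [l [r [R lU]]] := realized_rooted P bU i2 i3; exists (Node (tgt b) l r).
have [t {}tP] := fin_all_exists tP.
have triP a b c : tri a = Some (b, c) ->
    exists t, [/\ realized t, labels t =i U a & root t = Some (tgt b)].
  by move=> E; have := tP a; rewrite E /=; exists (t a).
have sU a : #|U a| = size (labels (t a)).
  have [[u _] tU _] := tP a; rewrite -(card_uniqP u); apply: eq_card => x; by rewrite tU.
case: m m2 v e bv be ve => // m m2 v e bv be ve.
(* The remainder identifies the index [m.+1] with [0], which closes the walk. *)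
pose vv j := val (v (inord (j %% m.+1))).
pose dd (j : nat) := src (e (inord j)) == v (inord j).
pose tt (j : nat) := t (val (e (inord j))).
pose w := [seq (dd j, tt j, vv j.+1) | j <- iota 0 m.+1].
have vvE (i : 'I_m.+1) : vv i = val (v i) by rewrite /vv modn_small // inord_val.
have vvS (i : 'I_m.+1) : vv i.+1 = val (v (ordS i)).
  by congr (val (v _)); apply: val_inj; rewrite /= inordK // ltn_pmod.
have eS (i : 'I_m.+1) : val (e i) \in arrows_in S by exact: valP.
have e_inj : injective (fun i => val (e i)) by move=> i j /val_inj/(bij_inj be).
have sumE (P : pred 'I_m.+1) (g : arrow Q -> nat) :
    \sum_(a in [set val (e i) | i : 'I_m.+1 & P i]) g a = \sum_(i | P i) g (val (e i)).
  rewrite big_imset /=; last by move=> i j _ _ /e_inj.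
  by apply: eq_bigl => i; rewrite inE.
have dirE (i : 'I_m.+1) : (tgt (e i) == v i) = ~~ (src (e i) == v i).
  move: (ve i); rewrite /joins; case: eqP => [<-|_] /=; last by case/andP.
  by move=> _; apply/negbTE/eqP => h; exact: (@no_loops (full_subquiver S) (e i) (esym h)).
have countE b : word_count b w = \sum_(i : 'I_m.+1 | (src (e i) == v i) == b) (1 + #|U (val (e
  i))|).
  rewrite /word_count big_map -[iota 0 m.+1]val_enum_ord big_map big_enum_cond /=.
  by apply: eq_big => [i|i _]; rewrite /dd /tt inord_val // sU.
exists (vv 0), w; split; first last.
- rewrite countE (param_weight H _ triP); last first.
    by apply/subsetP => a /imsetP[i _ ->].
  by rewrite sumE; apply: eq_bigl => i; rewrite dirE; case: (src (e i) == v i).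
- rewrite countE (param_weight H _ triP); last first.
    by apply/subsetP => a /imsetP[i _ ->].
  by rewrite sumE; apply: eq_bigl => i; case: (src (e i) == v i).
have labE y : count_mem y (word_labels w) = \sum_(i : 'I_m.+1)
    ((val (v (ordS i)) == y) + count_mem y (labels (t (val (e i))))).
  rewrite count_flatten -map_comp sumnE !big_map -[iota 0 m.+1]val_enum_ord big_map big_enum /=.
  by apply: eq_bigr => i _; rewrite vvS /tt inord_val.
have ordSb : bijective (@ordS m.+1) by exists (@ord_pred m.+1); [exact: ordSK | exact: ord_predK].
have tU i y : count_mem y (labels (t (val (e i)))) = (y \in U (val (e i))).
  by have [[u _] <- _] := tP (val (e i)); rewrite count_uniq_mem.
(* A vertex of [S] is the end of exactly one step; any other vertex lies in [U a] for exactly one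
   [a]. Uniqueness and completeness of the labels both follow from this count. *)
have count1 y : count_mem y (word_labels w) = 1.
  rewrite labE big_split /=.
  have -> : \sum_(i : 'I_m.+1) (val (v (ordS i)) == y) = \sum_(x in S) (x == y).
    rewrite [RHS]big_sub [RHS](reindex v) /=; last exact: onW_bij.
    by rewrite [in RHS](reindex (@ordS m.+1)) //=; exact: onW_bij.
  have -> : \sum_(i : 'I_m.+1) count_mem y (labels (t (val (e i)))) = \sum_(a in arrows_in S) (y
    \in U a).
    rewrite [RHS]big_sub [RHS](reindex e) /=; last exact: onW_bij.
    by apply: eq_bigr => i _; rewrite tU.
  have [yS|/(Qn_U_cover H)[a ya]] := boolP (y \in S).
    rewrite (bigD1 y) //= eqxx big1 => [|x /andP[_ /negbTE->]//].
    rewrite big1 // => a _; case: (boolP (y \in U a)) => // ya.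
    have /(Qn_U_cover H) : exists a, y \in U a by exists a.
    by rewrite yS.
  have yS : y \notin S by apply/(Qn_U_cover H); exists a.
  have aS : a \in arrows_in S.
    case E: (tri a) => [[b c]|]; first by case: (Qn_tri H E).
    by move: ya; rewrite (Qn_U0 H E) inE.
  rewrite big1 => [|x xS]; last by case: eqP => // xy; rewrite -xy xS in yS.
  rewrite (bigD1 a) //= ya big1 // => a' /andP[_ aa'].
  have /(Qn_U_disjoint H)/pred0P/(_ y) /= : a' <> a by apply/eqP.
  by rewrite ya andbT => ->.
split.
- by rewrite size_map size_iota.
- by rewrite /w -[m.+1]addn1 iotaD /= cats1 !map_rcons last_rcons /= /vv modnn mod0n.
- by apply: count_mem_uniq => y; rewrite count1 -has_pred1 has_count count1.
- by move=> y; rewrite -has_pred1 has_count count1.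
(* The untruncated equality is enough: since [Q] has no 2-cycles, the subtraction in [encodes] then
   changes nothing. *)
have nE y z : narrows y z = tris_narrows (word_tris (vv 0) w) y z.
  rewrite tris_narrows_word add0n big_mkord (narrows_blocks H tP) big_sub (reindex e) /=;
    last exact: onW_bij.
  apply: eq_bigr => i _; congr (_ + _); last by rewrite /tt inord_val.
  rewrite /dd /tt inord_val vvE vvS /step_tri /=.
  have [s|s] := eqVneq (src (e i)) (v i).
    have : tgt (e i) = v (ordS i).
      move: (ve i); rewrite /joins dirE s eqxx andbF orbF => /andP[_ /eqP//].
    by rewrite -s => <-.
  have tv : tgt (e i) = v i by apply/eqP; rewrite dirE.
  move: (ve i); rewrite /joins (negbTE s) /= => /andP[/eqP <- _].
  by rewrite -tv.
move=> y z; rewrite -!nE; have := narrows_2cycleM y z.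
by case: (narrows y z) => // p; case: (narrows z y) => // q; rewrite subn0.
Qed.

(** * Moves on words: splitting, swapping and reversing *)

Lemma word_tris_cat (V : Type) (x : V) w1 w2 :
  word_tris x (w1 ++ w2) = word_tris x w1 ++ word_tris (last x [seq s.2 | s <- w1]) w2.
Proof. by elim: w1 x => //= s w1 IH x; rewrite IH catA. Qed.

Lemma word_labels_cat (V : Type) (w1 w2 : seq (step V)) :
  word_labels (w1 ++ w2) = word_labels w1 ++ word_labels w2.
Proof. by rewrite /word_labels map_cat flatten_cat. Qed.

Lemma word_labels_cons (V : Type) (s : step V) w :
  word_labels (s :: w) = s.2 :: labels s.1.2 ++ word_labels w.
Proof. by []. Qed.

Lemma word_count_cat (V : Type) b (w1 w2 : seq (step V)) :
  word_count b (w1 ++ w2) = word_count b w1 + word_count b w2.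
Proof. exact: big_cat. Qed.

Lemma word_count_cons (V : Type) b (s : step V) w :
  word_count b (s :: w) = (s.1.1 == b) * (1 + size (labels s.1.2)) + word_count b w.
Proof. by rewrite /word_count big_cons; case: ifP; rewrite ?mul1n ?mul0n. Qed.

Lemma last_word (V : eqType) (x : V) w : last x [seq s.2 | s <- w] \in x :: word_labels w.
Proof.
elim: w x => [|s w IH] x; first exact: mem_head.
have := IH s.2; rewrite word_labels_cons /= !inE mem_cat => /orP[->|->]; rewrite !orbT //.
Qed.

Lemma last_word_cons (V : eqType) (x : V) s w :
  last x [seq s.2 | s <- s :: w] \in word_labels (s :: w).
Proof.
have := last_word s.2 w; rewrite word_labels_cons /= !inE mem_cat.
by case/orP => ->; rewrite ?orbT.
Qed.

Lemma word_narrows0 (V : eqType) (x z y : V) w : z != x -> z \notin word_labels w ->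
  tris_narrows (word_tris x w) y z = 0 /\ tris_narrows (word_tris x w) z y = 0.
Proof.
elim: w x => [|[[d t] s] w IH] x zx; first by rewrite !tris_narrows_nil.
rewrite word_labels_cons inE mem_cat !negb_or /= => /and3P[zs zt zw].
have [h1 h2] := IH s zs zw.
have sF (u : V) : z != u -> (Some u == Some z) = false.
  by move=> /negbTE zu; rewrite eq_sym; exact: zu.
have rt := root_labelsF zt.
rewrite !tris_narrowsE h1 h2 (tris_narrows0l _ zt) (tris_narrows0r _ zt).
by rewrite /step_tri /=; case: d; rewrite /tri_narrows /= rt !sF // !andbF.
Qed.

Ltac perm_lia := apply/permP => ?;
  rewrite ?word_labels_cat ?word_labels_cons /= ?count_cat;
  do ?[rewrite count_cat | progress rewrite /=]; clear; lia.

(** The diagonal [z] separates the triangle on the cycle from the top triangle of the tree. After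
    the flip [z] lies on the cycle, and each new triangle has one of the two subtrees on its outer
    side; the direction [d] decides which subtree comes first. *)
Lemma annular_split (Q : quiver) (x : vert Q) w1 d z l r y w2 :
  annular x (w1 ++ (d, Node z l r, y) :: w2) ->
  @annular (mutate z) x (w1 ++ (d, if d then r else l, z) :: (d, if d then l else r, y) :: w2).
Proof.
move=> [sw lw us ms eL]; set w' := w1 ++ _.
have pE : perm_eq (word_labels w') (word_labels (w1 ++ (d, Node z l r, y) :: w2)).
  by rewrite /w'; case: d {sw lw us ms eL w'}; perm_lia.
set p := last x [seq s.2 | s <- w1].
set W := word_labels w1 ++ word_labels w2.
have : uniq (z :: y :: W ++ labels l ++ labels r).
  by apply: etrans us; apply: perm_uniq; perm_lia.
rewrite /= !inE !mem_cat !negb_or -!andbA.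
move=> /and5P[zy z1 z2 zl] /and5P[zr y1 y2 yl] /andP[yr].
rewrite cat_uniq => /and3P[_ /hasPn Wlr]; rewrite cat_uniq => /and3P[_ /hasPn lr _].
have xE : x = last y [seq s.2 | s <- w2] by rewrite -[LHS]lw map_cat last_cat.
have zx : z != x.
  rewrite xE; apply: contraTneq (last_word y w2) => <-.
  by rewrite inE negb_or zy z2.
(* As the word has more than one step, [w1] or [w2] is nonempty; so the start [p] of the split step
   is one of their labels, hence different from [y]. *)
have pW : p \in W.
  rewrite /p /W mem_cat; case: (w1) sw => [|s w1'] sw; last by rewrite last_word_cons.
  by rewrite xE; case: (w2) sw => // s w2' _; rewrite last_word_cons.
have notW v : v \in W -> [/\ v != z, v != y, v \notin labels l & v \notin labels r].
  move=> vW; have vlr : v \notin labels l ++ labels r by apply/negP => /Wlr/negP; apply.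
  move: vlr; rewrite mem_cat negb_or => /andP[-> ->]; split=> //.
    by apply: contraTneq vW => ->; rewrite mem_cat negb_or z1 z2.
  by apply: contraTneq vW => ->; rewrite mem_cat negb_or y1 y2.
have [pz py pl pr] := notW p pW.
pose L := word_tris x w1 ++ tris l ++ tris r ++ word_tris y w2.
have sF (u v : vert Q) : u != v -> (Some u == Some v) = false by move=> /negbTE.
have eq2 (o o' : option (vert Q)) v : o == Some v -> o' == Some v -> o = o'.
  by move=> /eqP-> /eqP->.
have rl (t : tree (vert Q)) v : v \notin labels t -> root t <> Some v.
  by move=> vt /root_labels; apply/negP.
have llr : root l = root r -> root l = None.
  case E : (root l) => [v|] // /esym /root_labels /lr /negP; case.
  exact: root_labels.
split.
- by rewrite size_cat /= !addnS.
- by apply: etrans lw; rewrite !map_cat !last_cat.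
- by rewrite (perm_uniq pE).
- by move=> v; rewrite (perm_mem pE).
(* For both directions the triangle on the cycle becomes [(Some z, a, b)], the form expected by
   [encodes_flip]. *)
pose a := Some (if d then p else y); pose b := Some (if d then y else p).
apply: (@encodes_eq (mutate z) ((Some z, b, root l) :: (Some z, root r, a) :: L)).
  by rewrite /L /w' word_tris_cat /a /b -/p; case: (d); tris_lia.
apply: encodes_flip.
- by rewrite /a /b; case: (d); rewrite !inE !negb_or; apply/and4P; split; rewrite eq_sym;
    try (by apply/eqP; exact: rl); rewrite ?sF // eq_sym.
- move=> v; apply/negP => /andP[/orP h1 /orP h2]; move: h1 h2; rewrite /a /b.
  case=> h1 [h2|h2]; have := eq2 _ _ _ h1 h2; move: h1 h2; case: (d) => h1 _.
  + by move=> [py']; rewrite py' eqxx in py.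
  + by move=> [py']; rewrite py' eqxx in py.
  + by move=> /esym/rl; apply.
  + by move=> /esym/rl; apply.
  + by move=> /rl; apply.
  + by move=> /rl; apply.
  + by move=> /llr E; rewrite E in h1.
  + by move=> /llr E; rewrite E in h1.
- move=> v; rewrite /L !tris_narrowsE.
  have [-> ->] := word_narrows0 v zx z1; have [-> ->] := word_narrows0 v zy z2.
  by rewrite !(tris_narrows0l _ zl, tris_narrows0l _ zr, tris_narrows0r _ zl,
    tris_narrows0r _ zr).
- apply: encodes_eq eL; rewrite /L word_tris_cat /a /b -/p; case: (d); tris_lia.
Qed.

(** Two consecutive steps of opposite direction without trees make [k] a source or a sink, so no
    path runs through [k] and mutation only reverses its two arrows. *)
Lemma annular_swap (Q : quiver) (x : vert Q) w1 b k y w2 :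
  annular x (w1 ++ (b, Leaf, k) :: (~~ b, Leaf, y) :: w2) ->
  @annular (mutate k) x (w1 ++ (~~ b, Leaf, k) :: (b, Leaf, y) :: w2).
Proof.
move=> [sw lw us ms eL].
set p := last x [seq s.2 | s <- w1].
have : uniq (k :: y :: word_labels w1 ++ word_labels w2).
  by apply: etrans us; apply: perm_uniq; perm_lia.
rewrite /= !inE !mem_cat !negb_or -!andbA => /and4P[ky k1 k2 _].
have xE : x = last y [seq s.2 | s <- w2] by rewrite -[LHS]lw map_cat last_cat.
have kx : k != x.
  rewrite xE; apply: contraTneq (last_word y w2) => <-.
  by rewrite inE negb_or ky k2.
have kp : k != p.
  have := last_word x w1; rewrite -/p; apply: contraTneq => <-.
  by rewrite inE negb_or kx k1.
pose L := word_tris x w1 ++ word_tris y w2.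
have sF (u v : vert Q) : u != v -> (Some u == Some v) = false by move=> /negbTE.
split.
- by apply: leq_trans sw _; rewrite !size_cat leqnn.
- by apply: etrans lw; rewrite !map_cat !last_cat.
- by rewrite word_labels_cat; move: us; rewrite word_labels_cat; apply.
- by move=> v; rewrite word_labels_cat; have := ms v; rewrite word_labels_cat; apply.
(* The sides of the quadrilateral are alternately boundary edges and [p], [y]; the bit [b] tells
   which come first. In a word of two steps [p] and [y] coincide, which [encodes_flip] permits for
   opposite sides. *)
pose o (c : bool) (v : vert Q) := if c then Some v else None.
apply: (@encodes_eq (mutate k) ((Some k, o b p, o (~~ b) y) :: (Some k, o b y, o (~~ b) p) :: L)).
  by rewrite /L word_tris_cat -/p; case: (b); rewrite /o; tris_lia.
apply: encodes_flip.
- by rewrite /o; case: (b); rewrite !inE !negb_or; apply/and4P; split; rewrite ?sF.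
- by move=> v; rewrite /o; case: (b); rewrite /= ?andbF.
- move=> v; rewrite /L !tris_narrowsE.
  by have [-> ->] := word_narrows0 v kx k1; have [-> ->] := word_narrows0 v ky k2.
- by apply: encodes_eq eL; rewrite /L word_tris_cat -/p; case: (b); rewrite /o; tris_lia.
Qed.

Fixpoint rev_word (V : Type) (x : V) (w : seq (step V)) : seq (step V) :=
  if w is s :: w' then rcons (rev_word s.2 w') (~~ s.1.1, s.1.2, x) else [::].

Lemma rev_word_cons (V : Type) (x : V) s w :
  rev_word x (s :: w) = rev_word s.2 w ++ [:: (~~ s.1.1, s.1.2, x)].
Proof. by rewrite cats1. Qed.

(** This is the reflection of the drawing: the same triangles are met in the opposite order, and
    clockwise and anti-clockwise exchange their roles. *)
Lemma annular_rev (Q : quiver) (x : vert Q) w : annular x w -> annular x (rev_word x w).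
Proof.
move=> [sw lw us ms eL].
have last_rev z v (w' : seq (step (vert Q))) :
    last v [seq s.2 | s <- rev_word z w'] = if w' is [::] then v else z.
  by case: w' => //= s w'; rewrite map_rcons last_rcons.
(* For the induction the walk need not be closed: reversal trades its end for its start. In a closed
   walk they agree and cancel. *)
have count_rev z p : count p (word_labels (rev_word z w)) + p (last z [seq s.2 | s <- w])
    = count p (word_labels w) + p z.
  elim: (w) z => [|s w' IH] z //; rewrite rev_word_cons word_labels_cat !word_labels_cons.
  by have := IH s.2; rewrite cats0 /= !count_cat /=; clear; lia.
have perm_rev : perm_eq (word_labels (rev_word x w)) (word_labels w).
  by apply/permP => p; have := count_rev x p; rewrite lw => /addIn.
split.
- suff -> : size (rev_word x w) = size w by [].
  by elim: (w) (x) => //= s w' IH z; rewrite size_rcons IH.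
- by rewrite last_rev; case: (w) sw.
- by rewrite (perm_uniq perm_rev).
- by move=> y; rewrite (perm_mem perm_rev).
- apply: encodes_eq eL => y z; rewrite -[X in word_tris X (rev_word _ _)]lw.
  elim: (w) (x) => [|[[d t] u] w' IH] v //; rewrite rev_word_cons word_tris_cat last_rev /=.
  have -> : (if w' is [::] then last u [seq s.2 | s <- w'] else u) = u by case: (w').
  by rewrite !tris_narrowsE IH /step_tri /=; case: d => /=; lia.
Qed.

Lemma word_count_rev (V : Type) b (x : V) w : word_count b (rev_word x w) = word_count (~~ b) w.
Proof.
elim: w x => [|[[d t] y] w IH] x; first by rewrite /word_count !big_nil.
rewrite rev_word_cons word_count_cat !word_count_cons IH /= {2}/word_count big_nil.
by case: d; case: (b); clear => /=; lia.
Qed.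

(** * Reduction to a sorted plain cycle *)

Definition leaf_word (V : Type) (w : seq (step V)) : bool := all (fun s => nilp (labels s.1.2)) w.

Lemma leaf_word_or_node (V : Type) (w : seq (step V)) : leaf_word w \/
  exists w1 d z l r y w2, w = w1 ++ (d, Node z l r, y) :: w2.
Proof.
elim: w => [|[[d t] y] w [IH|[w1 [d' [z [l [r [y' [w2 ->]]]]]]]]]; first by left.
  case: t => [|z l r]; first by left.
  by right; exists [::], d, z, l, r, y, w.
by right; exists ((d, t, y) :: w1), d', z, l, r, y', w2.
Qed.

Lemma annular_leaf (Q : quiver) (x : vert Q) w : annular x w ->
  exists Q' (x' : vert Q') w', [/\ mutation_equivalent Q Q', annular x' w', leaf_word w'
    & forall b, word_count b w' = word_count b w].
Proof.
(* This difference is the number of tree nodes. A split keeps the labels and turns one node into a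
   step. *)
have [n] := ubnP (size (word_labels w) - size w).
elim: n Q x w => // n IH Q x w sn A.
have [lw|[w1 [d [z [l [r [y [w2 wE]]]]]]]] := leaf_word_or_node w.
  exists Q, x, w; split=> //; apply: mut_eq_iso; exists id, id.
  by split=> //; exists id.
subst w; have A' := annular_split A.
have sizeE (v : seq (step (vert Q))) : size v <= size (word_labels v).
  elim: v => // s v IHv; rewrite word_labels_cons /= size_cat ltnS.
  exact: leq_trans IHv (leq_addl _ _).
have h1 := sizeE w1; have h2 := sizeE w2.
have [|Q' [x' [w' [QQ' Aw' lw' cw']]]] := IH (mutate z) x _ _ A'.
  move: sn h1 h2.
  by case: (d); rewrite !word_labels_cat !word_labels_cons /= !size_cat /= !size_cat /= ?size_cat;
    clear; lia.
exists Q', x', w'; split=> // [|b]; first exact: mut_eq_step QQ'.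
rewrite cw' !word_count_cat !word_count_cons /=.
by case: (d); case: b; rewrite /= ?size_cat; clear; lia.
Qed.

Definition reaches (Q : quiver) (ds : seq bool) : Prop :=
  exists Q' (x' : vert Q') w', [/\ mutation_equivalent Q Q', annular x' w', leaf_word w'
    & [seq s.1.1 | s <- w'] = ds].

Lemma map_cat_inv (A B : Type) (f : A -> B) (s : seq A) (s1 s2 : seq B) : map f s = s1 ++ s2 ->
  exists t1 t2, [/\ s = t1 ++ t2, map f t1 = s1 & map f t2 = s2].
Proof.
move=> E; exists (take (size s1) s), (drop (size s1) s).
by rewrite cat_take_drop map_take map_drop E take_size_cat // drop_size_cat.
Qed.

Lemma reaches_swap Q d1 b d2 : reaches Q (d1 ++ b :: ~~ b :: d2) -> reaches Q (d1 ++ ~~ b :: b ::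
  d2).
Proof.
move=> [Q' [x [w [QQ' A lw /map_cat_inv[w1 [w2 [wE w1E w2E]]]]]]]; subst w.
case: w2 w2E A lw => [|[[b1 t1] k] [|[[b2 t2] y] w2]] //= [-> -> w2E] A.
rewrite /leaf_word all_cat /= => /and4P[lw1]; case: t1 A => // A _; case: t2 A => // A _ lw2.
exists (mutate k), x, (w1 ++ (~~ b, Leaf, k) :: (b, Leaf, y) :: w2); split.
- apply: (mutation_equivalent_trans QQ'); apply: mutation_equivalent_sym.
  apply: (@mut_eq_step (mutate k) _ k).
  exact/mut_eq_iso/isomorphic_mutateK.
- exact: annular_swap A.
- by rewrite /leaf_word all_cat /= lw1.
- by rewrite map_cat /= w1E w2E.
Qed.

Lemma reaches_bubble Q d1 a d2 :
  reaches Q (d1 ++ false :: nseq a true ++ d2) -> reaches Q (d1 ++ nseq a true ++ false :: d2).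
Proof.
elim: a d1 => //= a IH d1 /reaches_swap h.
by rewrite -cat_rcons; apply: IH; rewrite cat_rcons.
Qed.

(** Insertion sort: once the tail is sorted, a leading [false] is moved past all its [true]
    entries. *)
Lemma reaches_sort Q d1 d2 : reaches Q (d1 ++ d2) ->
  reaches Q (d1 ++ nseq (count id d2) true ++ nseq (count negb d2) false).
Proof.
elim: d2 d1 => // b d2 IH d1; rewrite -cat_rcons => /IH; rewrite cat_rcons.
by case: b => //= /reaches_bubble.
Qed.

Lemma annular_reaches (Q : quiver) (x : vert Q) w : annular x w ->
  reaches Q (nseq (word_count true w) true ++ nseq (word_count false w) false).
Proof.
move=> /annular_leaf[Q' [x' [w' [QQ' A lw cE]]]].
have countE b : word_count b w = count (pred1 b) [seq s.1.1 | s <- w'].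
  rewrite -cE; elim: (w') lw => [|s v IH] /=; first by rewrite /word_count big_nil.
  by move=> /andP[/nilP ls /IH]; rewrite word_count_cons ls muln1 => ->.
rewrite !countE.
rewrite (@eq_count _ (pred1 true) id) => [|[]//];
  rewrite (@eq_count _ (pred1 false) negb) => [|[]//].
by apply: (@reaches_sort Q [::]); exists Q', x', w'.
Qed.

Lemma tris_narrows_leaf_word (V V' : eqType) (f : V -> V') x w w' y z :
  injective f -> leaf_word w -> leaf_word w' ->
  [seq s.1.1 | s <- w'] = [seq s.1.1 | s <- w] ->
  [seq s.2 | s <- w'] = [seq f s.2 | s <- w] ->
  tris_narrows (word_tris (f x) w') (f y) (f z) = tris_narrows (word_tris x w) y z.
Proof.
move=> If; elim: w w' x => [|[[d t] u] w IH] [|[[d' t'] u'] w'] x //=.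
  by rewrite !tris_narrows_nil.
move=> /andP[]; case: t => // _ lw /andP[]; case: t' => // _ lw' [-> dE] [-> sE].
have fS v v' : (Some (f v) == Some (f v')) = (Some v == Some v') by exact: (inj_eq If).
by rewrite !tris_narrowsE IH // /step_tri /=; case: d; rewrite /tri_narrows /= !fS.
Qed.

(** A closed word without trees is determined by its directions up to renaming vertices, so matching
    vertices by position is an isomorphism of the two plain cycles. *)
Lemma reaches_mutation_equivalent (Q1 Q2 : quiver) ds :
  reaches Q1 ds -> reaches Q2 ds -> mutation_equivalent Q1 Q2.
Proof.
move=> [P1 [x1 [w1 [QP1 [_ l1 u1 m1 e1] lw1 d1]]]] [P2 [x2 [w2 [QP2 [_ l2 u2 m2 e2] lw2 d2]]]].
apply: (mutation_equivalent_trans QP1);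
  apply: mutation_equivalent_trans (mutation_equivalent_sym QP2).
apply: mut_eq_iso.
have leafE (V : Type) (w : seq (step V)) : leaf_word w -> word_labels w = [seq s.2 | s <- w].
  by elim: w => // s w IH /andP[/nilP ls /IH IHw]; rewrite word_labels_cons ls /= IHw.
rewrite !leafE // in u1 m1 u2 m2.
set y1 := [seq s.2 | s <- w1] in u1 m1 l1; set y2 := [seq s.2 | s <- w2] in u2 m2 l2.
have sz : size y1 = size y2 by rewrite !size_map -(size_map (fun s => s.1.1) w1) d1 -d2 size_map.
pose f v := nth x2 y2 (index v y1); pose g v := nth x1 y1 (index v y2).
have fK : cancel f g by move=> v; rewrite /g /f index_uniq ?nth_index // -sz index_mem.
have gK : cancel g f by move=> v; rewrite /g /f index_uniq ?nth_index // sz index_mem.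
have fE : y2 = [seq f s.2 | s <- w1].
  rewrite (map_comp f (fun s => s.2)) -/y1; apply: (@eq_from_nth _ x2); first by rewrite size_map.
  by move=> i; rewrite -sz => i1; rewrite (nth_map x1) // /f index_uniq.
(* Both starting vertices are the last entries of their words, so the matching by position respects
   them. *)
have fx : f x1 = x2.
  rewrite -l1 -l2 fE (map_comp f (fun s => s.2)) -/y1.
  by case: (y1) (m1 x1) => // v s _; rewrite /= last_map.
apply: (@isomorphic_narrows _ _ f); first by exists g.
by move=> u v; rewrite e1 e2 -fx !(tris_narrows_leaf_word _ _ _ (can_inj fK) lw1 lw2) // d1 d2.
Qed.

Theorem corollary3p11 (n : nat) (Q1 Q2 : quiver)
    (r1 r2 s1 s2 r1' r2' s1' s2' : nat) :
  1 <= n ->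
  in_Qn n Q1 -> in_Qn n Q2 ->
  has_parameters Q1 r1 r2 s1 s2 ->
  has_parameters Q2 r1' r2' s1' s2' ->
  (r1 + 2 * r2 = r1' + 2 * r2' /\ s1 + 2 * s2 = s1' + 2 * s2') \/
  (r1 + 2 * r2 = s1' + 2 * s2' /\ s1 + 2 * s2 = r1' + 2 * r2') ->
  mutation_equivalent Q1 Q2.
Proof.
move=> _ _ _ /has_parameters_annular[x1 [w1 [A1 c1 c1']]] /has_parameters_annular[x2 [w2 [A2 c2
  c2']]].
have := annular_reaches A1; rewrite c1 c1' => reach1.
case=> -[Er Es]; rewrite Er Es in reach1; apply: (reaches_mutation_equivalent reach1).
  by have := annular_reaches A2; rewrite c2 c2'.
(* When the two sums are exchanged, the second word is traversed backwards. *)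
by have := annular_reaches (annular_rev A2); rewrite !word_count_rev c2 c2'.
Qed.
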